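(* $\Omega_2^{cp}\cap\overline{\mathbb{D}}$ is the closure of the set of all roots in $\overline{\mathbb{D}}$ of all Parry polynomials $P_w$ associated to admissible words $w$.
   Context: $\overline{\mathbb{D}}$ is the closed unit disk in $\mathbb{C}$. Thurston set. A continuous self-map $f$ of a compact interval is unimodal if it has exactly one interior turning point $c$ (the critical point); it is critically periodic if $f^n(c)=c$ for some $n\geq 1$. Let $\mathcal{F}_2^{cp}$ be the family of continuous, unimodal, critically periodic interval self-maps, and let $h_{top}$ denote topological entropy. Set $\Omega_2^{cp}:=\overline{\{z\in\mathbb{C}\mid z\text{ is a Galois conjugate of }e^{h_{top}(f)}\text{ for some }f\in\mathcal{F}_2^{cp}\}}$. Words. A sequence is an element $w=w_1w_2\dots$ of $\{0,1\}^{\mathbb{N}}$ (indexed from 1); a word is a finite string $w_1\dots w_n$, $n\ge1$, in $\{0,1\}$; $w^\infty$ is the infinite concatenation of copies of $w$; $\sigma$ is the shift map $\sigma(w_1w_2w_3\dots)=w_2w_3\dots$. $\mathrm{Prefix}_n(w)=w_1\dots w_n$, and the cumulative sign is $s(w_1\dots w_n)=(-1)^{\sum_i w_i}$ ($+1$ for the empty word). The twisted lexicographic order on sequences: $w<_E w'$ iff there is $k\ge1$ with $\mathrm{Prefix}_{k-1}(w)=\mathrm{Prefix}_{k-1}(w')$ and $s(\mathrm{Prefix}_{k-1}(w))(w'_k-w_k)>0$. A sequence $w$ starting with $10$ is admissible if $\sigma^k(w)\le_E w$ for all $k\in\mathbb{N}$. A word $w$ is admissible if it has positive cumulative sign and $w^\infty$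 is admissible. Parry polynomials. With $f_{0,z}(x)=zx$, $f_{1,z}(x)=2-zx$, the Parry polynomial of a word $w=w_1\dots w_n$ with positive cumulative sign is $P_w(z):=f_{w_n,z}\circ\dots\circ f_{w_1,z}(1)-1$. *)

(* Defs.v *)
From HB Require Import structures.
From mathcomp Require Import all_boot all_order all_algebra.
From mathcomp Require Import all_classical all_reals all_analysis.
From mathcomp Require Import complex.

Set Implicit Arguments.
Unset Strict Implicit.
Unset Printing Implicit Defensive.

Import Order.TTheory GRing.Theory Num.Theory.
Import numFieldNormedType.Exports.

Local Open Scope classical_set_scope.
Local Open Scope ring_scope.
Local Open Scope complex_scope.

(* The topology of C is the metric topology of its modulus.                    *)
HB.instance Definition _ (R : realType) := NormedModule.copy R[i] R[i]^o.

(* Topological entropy is Bowen's: the limit as e -> 0 (a supremum, by         *)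
(* monotonicity in e) of the exponential growth rate of the maximal size of    *)
(* an (n, e)-separated subset of the compact set D.                            *)

Definition nseparated (R : realType) (D : set R) (f : R -> R)
    (n : nat) (e : R) (s : seq R) : Prop :=
  [/\ uniq s,
      (forall x, x \in s -> D x) &
      (forall x y, x \in s -> y \in s -> x != y ->
         exists2 k, (k < n)%N & e < `|iter k f x - iter k f y|)].

Definition max_nseparated (R : realType) (D : set R) (f : R -> R)
    (n : nat) (e : R) : \bar R :=
  ereal_sup [set ((size s)%:R : R)%:E | s in nseparated D f n e].

Definition topological_entropy (R : realType) (D : set R) (f : R -> R) : \bar R :=
  ereal_sup [set limn_esup (fun n => ((n%:R : R)^-1)%:E * lne (max_nseparated D f n e))%E
            | e in [set e : R | 0 < e]].

(* A self-map of [a, b] is represented by a total function, of which only the  *)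
(* values on [a, b] matter.                                                    *)

Definition interval_self_map (R : realType) (a b : R) (f : R -> R) : Prop :=
  [/\ a < b, {within `[a, b], continuous f} &
      forall x, x \in `[a, b] -> f x \in `[a, b]].

Definition interior_turning_point (R : realType) (a b : R) (f : R -> R) (c : R) : Prop :=
  (c \in `]a, b[) /\
  ((\forall x \near c, f x <= f c) \/ (\forall x \near c, f c <= f x)).

(* Uniqueness of the local extremum (in the wide sense) excludes plateaus: f   *)
(* is strictly monotone on each of [a, c] and [c, b], with opposite directions. *)
Definition unimodal (R : realType) (a b : R) (f : R -> R) (c : R) : Prop :=
  interval_self_map a b f /\
  (forall x, interior_turning_point a b f x <-> x = c).

Definition critically_periodic_unimodal (R : realType) (a b : R) (f : R -> R) : Prop :=
  exists c, unimodal a b f c /\ exists2 n, (0 < n)%N & iter n f c = c.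

Definition galois_conjugate (R : realType) (z x : R[i]) : Prop :=
  exists p : {poly rat},
    [/\ irreducible_poly p, root (map_poly ratr p) x & root (map_poly ratr p) z].

Definition Omega2cp (R : realType) : set R[i] :=
  closure [set z : R[i] | exists (a b : R) (f : R -> R) (h : R),
    [/\ critically_periodic_unimodal a b f,
        topological_entropy `[a, b] f = h%:E &
        galois_conjugate z (expR h)%:C]].

Definition closed_unit_disk (R : realType) : set R[i] := [set z : R[i] | `|z| <= 1].

(* Sequences are indexed from 0: the k-th letter in 1-based numbering is       *)
(* w k.-1; true is the letter 1.                                               *)

Definition word := seq bool.

Definition bin_seq := nat -> bool.

Definition seq_prefix (n : nat) (w : bin_seq) : word := mkseq w n.

Definition seq_shift (k : nat) (w : bin_seq) : bin_seq := fun i => w (k + i)%N.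

Definition word_power (w : word) : bin_seq := fun i => nth false w (i %% size w)%N.

Definition cumulative_sign (w : word) : int := (-1) ^+ (\sum_(b <- w) b)%N.

Definition twisted_lt (w w' : bin_seq) : Prop :=
  exists k : nat, seq_prefix k w = seq_prefix k w' /\
    0 < cumulative_sign (seq_prefix k w) * ((w' k)%:Z - (w k)%:Z).

Definition twisted_le (w w' : bin_seq) : Prop := w = w' \/ twisted_lt w w'.

Definition admissible_sequence (w : bin_seq) : Prop :=
  [/\ w 0%N = true, w 1%N = false & forall k, twisted_le (seq_shift k w) w].

Definition admissible_word (w : word) : Prop :=
  [/\ (0 < size w)%N, cumulative_sign w = 1 & admissible_sequence (word_power w)].

Definition parry_map (A : nzRingType) (b : bool) (z x : A) : A :=
  if b then 2 - z * x else z * x.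

(* foldl applies the map of the first letter first. *)
Definition parry (A : nzRingType) (w : word) (z : A) : A :=
  foldl (fun x b => parry_map b z x) 1 w - 1.

(* Main.v *)
Require Import Defs.
From mathcomp Require Import all_boot all_order all_algebra.
From mathcomp Require Import all_classical all_reals all_analysis.
From mathcomp Require Import complex.
From mathcomp Require Import ring lra zify.
From mathcomp Require polyrcf.
Import Order.TTheory GRing.Theory Num.Theory.
Import numFieldNormedType.Exports.
Set Implicit Arguments.
Unset Strict Implicit.
Unset Printing Implicit Defensive.
Local Open Scope classical_set_scope.
Local Open Scope ring_scope.
Local Open Scope complex_scope.

(** Both sides are the closure of the set of those z in the open disk at which some
    polynomial with coefficients 1 and -1 vanishes.

    The Parry polynomial of a word is, up to sign, z - 1 times such a polynomial, the
    kneading polynomial, whose coefficients are the signs of the suffixes of the word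
    (parryE). Hence the roots of Parry polynomials in the open disk belong to that
    set. So do the Galois conjugates of exp h, for h the entropy of a critically
    periodic unimodal map f: exp h is 1 or is itself a root of the kneading polynomial
    of the critical orbit (critically_periodic_entropy). To see this, the entropy is
    first identified with the growth rate of the number of itineraries of length n
    (entropy_le and entropy_ge). The numbers of itineraries between the critical point
    and the points of its orbit satisfy, up to bounded errors, a linear recursion
    whose characteristic polynomial is the kneading polynomial. Since itineraries are
    submultiplicative, their generating function diverges at its radius of
    convergence exp (- h), and this forces the polynomial to vanish at exp h
    (kneading_entropy).

    Conversely, let z be a root of a kneading polynomial with |z| < 1. The coefficients
    of low degree depend on the end of the word only, so words ending with many copies
    of the given one have roots near z, whatever they begin with
    (kneading_root_approx). Beginning them with 1 followed by a run of zeros longer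
    than the rest makes them admissible (long_run_admissible); with a length that is a
    power of two and a suitable padding, their kneading polynomials are irreducible by
    Eisenstein's criterion at 1 (padding_irreducible); and they are the kneading words
    of the critical orbits of explicit unimodal maps (long_run_entropy). Every nearby
    root is therefore at once a root of an admissible Parry polynomial and a Galois
    conjugate of some exp h.

    Limits on the unit circle cause no difficulty because the whole circle belongs to
    both closures: the roots of the kneading polynomial obtained from
    1 - z ^ M - z ^ (2 M) accumulate at every point of it (circle_near_roots). *)

(** * Kneading polynomials *)

(** The Parry polynomial without its trivial factor z - 1, see parryE: the
    coefficient of z ^ i is the sign of the last i letters of v. *)
Definition kneading (A : comNzRingType) (v : word) (z : A) : A :=
  foldl (fun q (b : bool) => 1 + (-1) ^+ b * z * q) 1 v.

Definition word_sign (A : comNzRingType) (v : word) : A :=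
  \prod_(b <- v) (-1) ^+ nat_of_bool b.

Section KneadingAlgebra.
Variable A : comNzRingType.
Implicit Types (v : word) (z : A).

Lemma kneading_rcons v (b : bool) z :
  kneading (rcons v b) z = 1 + (-1) ^+ b * z * kneading v z.
Proof. by rewrite /kneading -cats1 foldl_cat. Qed.

Lemma word_sign_cat v v' : word_sign A (v ++ v') = word_sign A v * word_sign A v'.
Proof. by rewrite /word_sign big_cat. Qed.

Lemma word_sign_rcons v (b : bool) : word_sign A (rcons v b) = word_sign A v * (-1) ^+ b.
Proof. by rewrite -cats1 word_sign_cat /word_sign big_seq1. Qed.

Lemma word_sign_cons v (b : bool) : word_sign A (b :: v) = (-1) ^+ b * word_sign A v.
Proof. by rewrite /word_sign big_cons. Qed.

Lemma kneading_cat v v' z :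
  kneading (v ++ v') z =
  kneading v' z + word_sign A v' * z ^+ size v' * (kneading v z - 1).
Proof.
elim/last_ind: v' => [|v' b IH].
  by rewrite cats0 /word_sign big_nil expr0 !mul1r addrC subrK.
rewrite -rcons_cat !kneading_rcons IH word_sign_rcons size_rcons exprS; ring.
Qed.

(** The fixed point 1 of both Parry maps at z = 1 accounts for the factor z - 1. *)
Lemma parryE v (b : bool) z :
  parry (rcons v b) z = (-1) ^+ b * ((z - 1) * kneading v z).
Proof.
have E u : z * foldl (fun x b => parry_map b z x) 1 u = 1 + (z - 1) * kneading u z.
  elim/last_ind: u => [|u c IH]; first by rewrite /kneading /=; ring.
  rewrite -cats1 foldl_cat /= cats1 kneading_rcons /parry_map.
  by case: c; rewrite IH /= ?expr1 ?expr0; ring.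
rewrite /parry -cats1 foldl_cat /= /parry_map.
by case: b; rewrite E /= ?expr1 ?expr0; ring.
Qed.

(** In characteristic two all the signs disappear, so every kneading polynomial
    becomes a geometric sum. *)
Lemma kneading_pchar2 v z : 2%N \in [pchar A] ->
  kneading v z = \sum_(i < (size v).+1) z ^+ i.
Proof.
move=> ch; have N1 : (-1 : A) = 1.
  by apply/eqP; rewrite eq_sym -subr_eq0 opprK -mulr2n pcharf0.
elim/last_ind: v => [|v b IH]; first by rewrite big_ord1.
rewrite kneading_rcons IH size_rcons [RHS]big_ord_recl expr0 N1 expr1n mul1r mulr_sumr.
by congr (_ + _); apply: eq_bigr => i _; rewrite exprS.
Qed.

Lemma word_sign_sqr v : word_sign A v * word_sign A v = 1.
Proof.
elim: v => [|b v IH]; first by rewrite /word_sign big_nil mul1r.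
by rewrite word_sign_cons mulrACA IH mulr1 -expr2 sqrr_sign.
Qed.

End KneadingAlgebra.

Lemma kneading_morph (A B : comNzRingType) (g : {rmorphism A -> B}) v (z : A) :
  g (kneading v z) = kneading v (g z).
Proof.
elim/last_ind: v => [|v b IH]; first by rewrite rmorph1.
by rewrite !kneading_rcons rmorphD rmorph1 !rmorphM /= rmorph_sign IH.
Qed.

Lemma map_poly_kneading (A B : comNzRingType) (g : {rmorphism A -> B}) v :
  map_poly g (kneading v 'X) = kneading v 'X.
Proof. by rewrite (kneading_morph (map_poly g)) /= map_polyX. Qed.

Lemma horner_kneading (A : comNzRingType) v (z : A) :
  (kneading v 'X).[z] = kneading v z.
Proof.
by rewrite -/(horner_eval z _) (kneading_morph (horner_eval z)) /= /horner_eval hornerX.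
Qed.

Lemma size_lead_kneading (A : comNzRingType) v :
  size (kneading v 'X : {poly A}) = (size v).+1 /\
  lead_coef (kneading v 'X : {poly A}) = word_sign A v.
Proof.
elim/last_ind: v => [|v b [IHs IHl]].
  by rewrite /kneading /= /word_sign big_nil size_poly1 lead_coef1.
rewrite kneading_rcons size_rcons word_sign_rcons.
have -> : (-1) ^+ b * 'X * kneading v 'X = (-1) ^+ b *: (kneading v 'X * 'X) :> {poly A}.
  by rewrite -mulrA ['X * _]mulrC -signr_odd -polyC1 -polyCN -polyC_exp mul_polyC signr_odd.
have Nz : (kneading v 'X : {poly A}) != 0 by rewrite -size_poly_eq0 IHs.
have S : size ((-1) ^+ b *: (kneading v 'X * 'X) : {poly A}) = (size v).+2.
  by rewrite -signr_odd; case: (odd b); rewrite /= ?expr1 ?scaleN1r ?expr0 ?scale1r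
    ?size_polyN size_mulX // IHs.
split.
  by rewrite addrC size_polyDl S // size_poly1.
rewrite addrC lead_coefDl ?S ?size_poly1 //.
rewrite -signr_odd; case: (odd b); rewrite /= ?expr1 ?scaleN1r ?expr0 ?scale1r.
  by rewrite lead_coefN lead_coefMX IHl mulrN1.
by rewrite lead_coefMX IHl mulr1.
Qed.

(** Modulo two and after the substitution of X + 1, the polynomial is a pure
    power of X, because its degree is one less than a power of two; the
    hypothesis on the value at 1 is then Eisenstein's condition on the constant
    coefficient. *)
Lemma kneading_irreducible (v : word) (k : nat) :
  (size v).+1 = (2 ^ k)%N -> (0 < k)%N -> ~~ (4 %| kneading v (1 : int))%Z ->
  irreducible_poly (kneading v 'X : {poly rat}).
Proof.
move=> sz k0 N4.
pose s (A : comNzRingType) : {poly A} := kneading v ('X + 1).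
have sE (A : comNzRingType) : s A = kneading v 'X \Po ('X + 1%:P).
  by rewrite (kneading_morph (comp_poly ('X + 1%:P))) /= comp_polyX.
have size_s : size (s int) = (size v).+1.
  by rewrite sE size_comp_poly2 ?size_XaddC //; case: (size_lead_kneading int v).
have lead_s : lead_coef (s int) = word_sign int v.
  rewrite sE lead_coef_comp ?size_XaddC // lead_coefXaddC expr1n mulr1.
  by case: (size_lead_kneading int v).
have F2 : map_poly (intr : int -> 'F_2) (s int) = 'X ^+ (size v).
  have -> : map_poly (intr : int -> 'F_2) (s int) = s 'F_2.
    rewrite /s (kneading_morph (map_poly (intr : {rmorphism int -> 'F_2}))) /=.
    by rewrite rmorphD /= map_polyX rmorph1.
  have ch : 2%N \in [pchar {poly 'F_2}] by rewrite pchar_poly pchar_Fp.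
  apply: (@mulfI _ 'X); first by rewrite polyX_eq0.
  rewrite -exprS /s kneading_pchar2 // -[X in X * _](addrK 1) -subrX1 sz.
  rewrite exprDn_pchar ?expr1n ?addrK //.
  by rewrite pnatX pnatE // ch.
have irr_s : irreducible_poly (s rat).
  have -> : s rat = map_poly intr (s int).
    by rewrite /s (kneading_morph (map_poly intr)) /= rmorphD /= map_polyX rmorph1.
  apply/irreducible_rat_int; apply: (@eisenstein_crit 2) => //.
  - by rewrite size_s sz -[1%N]/(2 ^ 0)%N eqn_exp2l // -lt0n.
  - rewrite lead_s; apply/negP => /dvdzP [c Ec].
    have := word_sign_sqr int v; rewrite Ec; lia.
  - by rewrite -horner_coef0 sE horner_comp !hornerE horner_kneading.
  - move=> i; rewrite size_s /= => lti.
    rewrite (dvdz_pcharf (pchar_Fp (isT : prime 2))).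
    have /(congr1 (fun p : {poly _} => p`_i)) := F2.
    by rewrite coef_map coefXn (ltn_eqF lti) => ->.
case: irr_s => s1 sdiv; split.
  by move: s1; rewrite sE size_comp_poly2 ?size_XaddC.
move=> q q1 qv.
have := sdiv (q \Po ('X + 1%:P)); rewrite size_comp_poly2 ?size_XaddC // sE.
move=> /(_ q1 (dvdp_comp_poly _ qv)) /andP [h1 h2].
by apply/andP; split; [have := dvdp_comp_poly ('X - 1%:P) h1
  | have := dvdp_comp_poly ('X - 1%:P) h2]; rewrite !comp_polyXaddC_K.
Qed.

(** * Admissible words beginning with a long run of zeros *)

Definition long_run_word (N : nat) (u : word) : word :=
  true :: nseq N false ++ true :: u.

Lemma size_long_run N u : size (long_run_word N u) = (N + size u).+2.
Proof. by rewrite /= size_cat size_nseq /= addnS. Qed.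

Lemma word_sign_nseq0 (A : comNzRingType) N : word_sign A (nseq N false) = 1.
Proof. by rewrite /word_sign big_nseq expr0 iter_fix ?mulr1. Qed.

Lemma word_sign_long_run (A : comNzRingType) N u :
  word_sign A (long_run_word N u) = word_sign A u.
Proof.
by rewrite word_sign_cons word_sign_cat word_sign_nseq0 mul1r word_sign_cons
  mulrA -expr2 sqrr_sign mul1r.
Qed.

Lemma kneading1_parity (u : word) :
  exists c : int, kneading u (1 : int) + (size u).+1%:Z = 2 * c.
Proof.
elim/last_ind: u => [|u b [c E]]; first by exists 1.
rewrite kneading_rcons size_rcons mulr1.
by case: b; rewrite ?expr1 ?expr0; [exists ((size u).+2%:Z - c)|exists (c + 1)]; lia.
Qed.

Lemma kneading1_long_run N (u : word) : word_sign int u = 1 ->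
  kneading (long_run_word N u) (1 : int) = kneading u 1 - N%:Z.
Proof.
have E0 (q : int) M : foldl (fun q (b : bool) => 1 + (-1) ^+ b * 1 * q) q (nseq M false)
    = q + M%:Z.
  elim: M q => [|M IH] q /=; first by rewrite addr0.
  by rewrite IH expr0; lia.
move=> su; have -> : long_run_word N u = rcons (true :: nseq N false) true ++ u.
  by rewrite /long_run_word -cats1 -catA.
rewrite kneading_cat su kneading_rcons expr1n.
have -> : kneading (true :: nseq N false) (1 : int) = N%:Z.
  by rewrite /kneading /= E0 expr1; lia.
rewrite expr1; ring.
Qed.

(** A zero in front of t raises both the value at 1 and the length by one. Their
    sum is odd, hence one of the two choices gives it the residue modulo 4 that
    turns, once the long run is added, into Eisenstein's condition. *)
Lemma padding_irreducible (t : word) : word_sign int t = 1 ->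
  exists2 u0 : word, (size u0 <= 1)%N /\ word_sign int (u0 ++ t) = 1 &
    forall N k, (2 <= k)%N -> (size (long_run_word N (u0 ++ t))).+1 = (2 ^ k)%N ->
      irreducible_poly (kneading (long_run_word N (u0 ++ t)) 'X : {poly rat}).
Proof.
move=> st.
have [u0 [su0 s0] [c Ec]] : exists2 u0 : word,
    (size u0 <= 1)%N /\ word_sign int (u0 ++ t) = 1 &
    exists c : int, kneading (u0 ++ t) (1 : int) + (size (u0 ++ t)).+1%:Z = 4 * c.
  have [c E] := kneading1_parity t.
  have [d [Ed|Ed]] : exists d : int, c = 2 * d \/ c = 2 * d + 1.
    exists (c %/ 2)%Z; have := divz_eq c 2.
    by have := modz_ge0 c (isT : 2 != 0 :> int); have := ltz_mod c (isT : 2 != 0 :> int); lia.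
    by exists [::]; [rewrite st | exists d; rewrite cat0s; lia].
  exists [:: false].
    by rewrite /= word_sign_cons expr0 mul1r st.
  exists (d + 1); rewrite cat1s -[_ :: _]cat1s kneading_cat st expr1n /kneading /=.
  by move: E; rewrite /kneading expr0 /=; lia.
exists u0 => // N k k2 sz; apply: (kneading_irreducible sz); first by lia.
clear -sz Ec k2 s0; rewrite kneading1_long_run //; move: sz; rewrite size_long_run.
have [m ->] : exists m, k = m.+2 by exists k.-2; lia.
rewrite !expnS => sz; apply/negP => /dvdzP [e]; move: Ec sz.
move: (kneading _ _) (size _) (2 ^ m)%N => x j M Ec sz Ee. lia.
Qed.

Lemma cumulative_signE (w : word) : cumulative_sign w = word_sign int w.
Proof.
rewrite /cumulative_sign /word_sign; elim: w => [|b w IH]; first by rewrite !big_nil.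
by rewrite !big_cons exprD IH.
Qed.

(** The initial run of zeros is longer than half of the word, hence longer than
    any other run in its periodic repetition; in the twisted order the sequence
    with the longest run after an initial 1 is the largest. *)
Lemma long_run_admissible N (u : word) : word_sign int u = 1 ->
  ((size u).+3 <= N)%N -> admissible_word (rcons (long_run_word N u) false).
Proof.
move=> su leN; set w := rcons _ _; set n := size w; set W := word_power w.
have nE : n = (N + size u).+3 by rewrite /n size_rcons size_long_run.
have w0 : nth false w 0 = true by [].
have wN i : (0 < i <= N)%N -> nth false w i = false.
  case: i => // i /= ltiN; rewrite -cats1 -catA nth_cat size_nseq ltiN.
  by rewrite nth_nseq ltiN.
have W0 : W 0%N = true by rewrite /W /word_power mod0n.
have WN i : (0 < i <= N)%N -> W i = false.
  by move=> iN; rewrite /W /word_power modn_small ?wN // -/n; lia.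
split; first by rewrite size_rcons.
  by rewrite cumulative_signE word_sign_rcons word_sign_long_run su.
split=> //; first by rewrite -/W WN //; lia.
move=> k; rewrite -/W.
have [r0|rpos] := posnP (k %% n).
  left; apply: funext => i; rewrite /seq_shift /W /word_power -/n.
  by rewrite -modnDml r0 add0n.
right; case Wk: (W k); last first.
  by exists 0%N; split=> //; rewrite cumulative_signE /word_sign big_nil /seq_shift addn0 Wk W0.
have ltrn : (k %% n < n)%N by rewrite ltn_mod nE.
have rN : (N < k %% n)%N.
  rewrite ltnNge; apply/negP => leNr.
  by move: Wk; rewrite /W /word_power wN // rpos.
have ex : exists i, (0 < i)%N && W (k + i)%N.
  exists (n - k %% n)%N; rewrite subn_gt0 ltrn /= /W /word_power -/n.
  by rewrite -modnDml subnKC ?modnn // ltnW.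
have := ex_minnP ex; case=> i /andP[i0 Wi] imin.
have leiN : (i <= N)%N.
  have /imin : (0 < n - k %% n)%N && W (k + (n - k %% n))%N.
    rewrite subn_gt0 ltrn /= /W /word_power -/n.
    by rewrite -modnDml subnKC ?modnn // ltnW.
  lia.
exists i; split.
  apply/eq_in_map => j; rewrite mem_iota add0n => /andP[_ ltji]; rewrite /seq_shift.
  case: j ltji => [|j] ltji; first by rewrite addn0 W0 Wk.
  rewrite (WN j.+1); last lia.
  apply/negbTE/negP => Wj.
  by have := imin j.+1; rewrite Wj => /(_ isT); lia.
have -> : seq_prefix i (seq_shift k W) = true :: nseq i.-1 false.
  case: i i0 Wi imin leiN => // i _ Wi imin leiN.
  rewrite /seq_prefix /mkseq /= {1}/seq_shift addn0 Wk; congr (_ :: _).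
  apply: (@eq_from_nth _ false); first by rewrite size_map size_iota size_nseq.
  move=> j; rewrite size_map size_iota => ltji.
  rewrite (nth_map 0%N) ?size_iota // nth_iota // nth_nseq ltji /seq_shift.
  apply/negbTE/negP => Wj; have := imin (1 + j)%N; rewrite Wj => /(_ isT); lia.
rewrite cumulative_signE word_sign_cons word_sign_nseq0 /seq_shift Wi WN ?i0 //.
Qed.

(** * Locating roots by a discrete Jensen formula *)

Notation cmod := (@Normc.normc _).

Section Modulus.
Variable R : realType.
Implicit Types x y z : R[i].

Lemma normC_cmod z : `|z| = (cmod z)%:C.
Proof. by []. Qed.

Lemma cmod_ge0 z : 0 <= cmod z.
Proof. by rewrite -lecR -normC_cmod normr_ge0. Qed.

Lemma cmodM x y : cmod (x * y) = cmod x * cmod y.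
Proof. exact: Normc.normcM. Qed.

Lemma cmod1 : cmod (1 : R[i]) = 1.
Proof. exact: Normc.normc1. Qed.

Lemma cmodN x : cmod (- x) = cmod x.
Proof. exact: normcN. Qed.

Lemma cmodD x y : cmod (x + y) <= cmod x + cmod y.
Proof. exact: le_normcD. Qed.

Lemma cmodB_ge x y : cmod x - cmod y <= cmod (x - y).
Proof. by have := cmodD (x - y) y; rewrite subrK; lra. Qed.

Lemma cmodX x n : cmod (x ^+ n) = cmod x ^+ n.
Proof. by elim: n => [|n IH]; rewrite ?expr0 ?cmod1 // !exprS cmodM IH. Qed.

Lemma cmod_real (t : R) : cmod t%:C = `|t|.
Proof. by rewrite /Normc.normc /= expr0n addr0 sqrtr_sqr. Qed.

Lemma cmod_eq0 x : (cmod x == 0) = (x == 0).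
Proof. by apply/eqP/eqP => [/Normc.eq0_normc //|->]; rewrite Normc.normc0. Qed.

Lemma cmod_gt0 x : (0 < cmod x) = (x != 0).
Proof. by rewrite lt_def cmod_ge0 cmod_eq0 andbT. Qed.

Lemma cmod_prod (I : Type) (r : seq I) (F : I -> R[i]) :
  cmod (\prod_(i <- r) F i) = \prod_(i <- r) cmod (F i).
Proof. by elim/big_rec2: _ => [|i x y _ IH]; rewrite ?cmod1 // cmodM IH. Qed.

Lemma cmod_sign (b : bool) : cmod ((-1) ^+ b : R[i]) = 1.
Proof. by rewrite cmodX cmodN cmod1 expr1n. Qed.

(** Multiply the values of F at the points z0 + rho * zeta, for zeta ranging over
    the D-th roots of unity and D the degree of F: each root r contributes
    (z0 - r) ^ D up to an error rho ^ D, which is at most as large when r is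
    outside the circle. The product is thus at most (2 |F(z0)|) ^ D. *)
Lemma min_modulus (F : {poly R[i]}) (z0 : R[i]) (rho mu : R) :
  0 < rho -> 0 <= mu -> F != 0 ->
  (forall r, root F r -> rho <= cmod (r - z0)) ->
  (forall zeta, cmod zeta = 1 -> mu <= cmod (F.[z0 + rho%:C * zeta])) ->
  mu <= 2 * cmod (F.[z0]).
Proof.
move=> rho0 mu0 F0 Froot Fmu.
have [r Er] := closed_field_poly_normal F.
set l := lead_coef F in Er.
have EF z : F.[z] = l * \prod_(x <- r) (z - x).
  rewrite Er hornerZ horner_prod; congr (_ * _).
  by apply: eq_bigr => x _; rewrite hornerXsubC.
have rP x : x \in r -> rho <= cmod (x - z0).
  move=> xr; apply: Froot; rewrite Er rootZ ?lead_coef_eq0 // root_prod_XsubC //.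
have [D0|D0] := posnP (size r).
  have := Fmu 1 cmod1; rewrite !EF (size0nil D0) !big_nil => h.
  by rewrite (le_trans h) // ler_peMl ?cmod_ge0 ?ler1n.
set D := size r in D0 *.
have [s Es] := closed_field_poly_normal ('X^D - 1 : {poly R[i]}).
have lead1 : lead_coef ('X^D - 1 : {poly R[i]}) = 1.
  by rewrite lead_coefDl ?lead_coefXn // size_polyXn size_polyN size_poly1.
rewrite lead1 scale1r in Es.
have sizes : size s = D.
  apply: succn_inj; rewrite -(size_prod_XsubC s id) -Es.
  by rewrite size_polyDl ?size_polyXn // size_polyN size_poly1 ltnS.
have Ps t : \prod_(x <- s) (t - x) = t ^+ D - 1.
  have /(congr1 (fun p => p.[t])) := Es.
  rewrite hornerD hornerXn hornerN hornerC horner_prod => ->; apply: eq_bigr => x _.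
  by rewrite hornerXsubC.
have s1 x : x \in s -> cmod x = 1.
  move=> xs; have : root ('X^D - 1) x by rewrite Es root_prod_XsubC.
  rewrite rootE !hornerE subr_eq0 => /eqP xD.
  apply/eqP; rewrite -(@pexpr_eq1 _ _ D) ?cmod_ge0 // -cmodX.
  by rewrite xD cmod1.
have rho_neq0 : rho%:C != 0 :> R[i] by rewrite -cmod_eq0 cmod_real normr_eq0 gt_eqF.
have H1 : mu ^+ D <= \prod_(x <- s) cmod (F.[z0 + rho%:C * x]).
  rewrite -sizes; elim: (s) s1 => [|x s' IH] s1'; first by rewrite big_nil.
  rewrite big_cons exprS; apply: ler_pM => //; first exact: exprn_ge0.
    by apply: Fmu; rewrite s1' ?mem_head.
  by apply: IH => y ys; rewrite s1' // in_cons ys orbT.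
have H2 : \prod_(x <- s) cmod (F.[z0 + rho%:C * x]) <= (2 * cmod (F.[z0])) ^+ D.
  under eq_bigr do rewrite EF cmodM cmod_prod.
  rewrite big_split /= exchange_big /= EF cmodM cmod_prod mulrCA exprMn.
  have -> : \prod_(x <- s) cmod l = cmod l ^+ D.
    by rewrite big_const_seq count_predT sizes iter_mulr_1.
  apply: ler_wpM2l; first by rewrite exprn_ge0 ?cmod_ge0.
  rewrite exprMn -/D.
  have -> : 2 ^+ D * (\prod_(x <- r) cmod (z0 - x)) ^+ D
     = \prod_(x <- r) (2 * cmod (z0 - x) ^+ D).
    by rewrite big_split /= prodrXl big_const_seq count_predT iter_mulr_1.
  rewrite big_seq [leRHS]big_seq; apply: ler_prod => y yr.
  rewrite prodr_ge0 /=; last by move=> *; exact: cmod_ge0.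
  rewrite -cmod_prod.
  have -> : \prod_(x <- s) (z0 + rho%:C * x - y) =
            (- rho%:C) ^+ D * (((y - z0) / rho%:C) ^+ D - 1).
    rewrite -Ps -sizes.
    elim: (s) => [|x s' IH]; first by rewrite !big_nil expr0 mul1r.
    rewrite !big_cons IH /= exprS mulrACA; congr (_ * _); field.
    exact: rho_neq0.
  have -> : (- rho%:C) ^+ D * (((y - z0) / rho%:C) ^+ D - 1) =
            (z0 - y) ^+ D - (- rho%:C) ^+ D.
    rewrite mulrBr mulr1 -exprMn; congr (_ ^+ _ - _); field; exact: rho_neq0.
  have := cmodD ((z0 - y) ^+ D) (- (- rho%:C) ^+ D).
  rewrite cmodN !cmodX cmodN cmod_real gtr0_norm //.
  have : rho ^+ D <= cmod (z0 - y) ^+ D.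
    have h : rho <= cmod (z0 - y) by rewrite -cmodN opprB; exact: rP.
    by apply: lerXn2r => //; rewrite nnegrE ?cmod_ge0 ?ltW.
  lra.
rewrite -(@ler_pXn2r _ D) ?nnegrE ?mulr_ge0 ?cmod_ge0 ?ler0n //.
exact: le_trans H1 H2.
Qed.

(** Radii for which the circle stays away from every root, the centre apart,
    exist below every positive bound, because the roots are finitely many. *)
Lemma circle_lower_bound (F : {poly R[i]}) (z0 : R[i]) (e : R) :
  F != 0 -> 0 < e ->
  exists rho mu : R, [/\ 0 < rho <= e, 0 < mu &
    forall zeta, cmod zeta = 1 -> mu <= cmod (F.[z0 + rho%:C * zeta])].
Proof.
move=> F0 e0; have [r Er] := closed_field_poly_normal F.
have [rho /andP[rho0 rhoe] rhoP] : exists2 rho : R, 0 < rho <= e &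
    forall x, x \in r -> x != z0 -> 2 * rho <= cmod (x - z0).
  elim: {Er} r => [|x r [rho /andP[rho0 rhoe] IH]]; first by exists e; rewrite ?e0 /=.
  have [->|xz] := eqVneq x z0.
    exists rho; first by rewrite rho0.
    by move=> y; rewrite in_cons => /predU1P[->|/IH //]; rewrite eqxx.
  have x0 : 0 < cmod (x - z0) by rewrite cmod_gt0 subr_eq0.
  exists (Num.min rho (cmod (x - z0) / 2)).
    by rewrite lt_min rho0 /= ge_min rhoe andbT; lra.
  move=> y; rewrite in_cons => /predU1P[-> _|/IH h /h {}h].
    have : Num.min rho (cmod (x - z0) / 2) <= cmod (x - z0) / 2 by rewrite ge_min lexx orbT.
    lra.
  have : Num.min rho (cmod (x - z0) / 2) <= rho by rewrite ge_min lexx.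
  lra.
exists rho, (cmod (lead_coef F) * rho ^+ size r); split; first by rewrite rho0.
  by rewrite mulr_gt0 ?exprn_gt0 // cmod_gt0 lead_coef_eq0.
move=> zeta z1; rewrite {2}Er hornerZ horner_prod cmodM cmod_prod.
apply: ler_wpM2l; first exact: cmod_ge0.
elim: {Er} r rhoP => [|x r IH] rP; first by rewrite big_nil.
rewrite big_cons exprS; apply: ler_pM; [exact: ltW|by rewrite exprn_ge0 ?ltW| |].
  rewrite hornerXsubC; have [->|xz] := eqVneq x z0.
    by rewrite addrAC subrr add0r cmodM cmod_real z1 mulr1 gtr0_norm.
  have := rP x (mem_head _ _) xz.
  have -> : z0 + rho%:C * zeta - x = rho%:C * zeta - (x - z0) by ring.
  have := cmodB_ge (x - z0) (rho%:C * zeta).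
  rewrite -[cmod (_ - _ * _)]cmodN opprB cmodM cmod_real z1 mulr1 gtr0_norm //; lra.
by apply: IH => y yr; apply: rP; rewrite in_cons yr orbT.
Qed.

Lemma expr_lt_eps (r e : R) : 0 <= r < 1 -> 0 < e -> exists n, r ^+ n < e.
Proof.
move=> /andP[r0 r1] e0.
have : (GRing.exp r : R^nat) @ \oo --> (0 : R) by apply: cvg_expr; rewrite ger0_norm.
move/cvgrPdist_lt => /(_ _ e0) [n _ /(_ n (leqnn n))] /=.
by rewrite sub0r normrN ger0_norm ?exprn_ge0 //; exists n.
Qed.

Lemma cmod_kneading_le (v : word) (z : R[i]) (r : R) :
  cmod z <= r -> r < 1 -> cmod (kneading v z) <= (1 - r)^-1.
Proof.
move=> zr r1; have r0 : 0 <= r := le_trans (cmod_ge0 z) zr.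
have d0 : 0 < 1 - r by rewrite subr_gt0.
elim/last_ind: v => [|v b IH].
  rewrite (_ : kneading [::] z = 1) // cmod1 -[leLHS]invr1 lef_pV2 ?posrE //; lra.
rewrite kneading_rcons (le_trans (cmodD _ _)) // !cmodM cmod_sign cmod1 mul1r.
have -> : (1 - r)^-1 = 1 + r * (1 - r)^-1 by field; rewrite gt_eqF.
by rewrite lerD2l ler_pM ?cmod_ge0.
Qed.

End Modulus.

(** * Approximating a root by roots of words with a prescribed prefix *)

Lemma word_sign_letter (v : word) :
  exists b : bool, forall A : comNzRingType, word_sign A v = (-1) ^+ b.
Proof.
elim: v => [|c v [b IH]]; first by exists false => A; rewrite /word_sign big_nil.
by exists (c (+) b) => A; rewrite word_sign_cons IH signr_addb.
Qed.

Lemma kneading_repeat (A : comNzRingType) (x v : word) (b : bool) j (z : A) :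
  word_sign A v = (-1) ^+ b ->
  let Z := z ^+ (size v).+1 in
  kneading (x ++ flatten (nseq j (b :: v))) z =
  kneading v z * (\sum_(i < j) Z ^+ i) + Z ^+ j * kneading x z.
Proof.
move=> sv Z; elim: j x => [|j IH] x.
  by rewrite cats0 big_ord0 mulr0 add0r expr0 mul1r.
rewrite /= -cat_cons catA IH -cat_rcons kneading_cat kneading_rcons sv big_ord_recr /=.
have -> : 1 + (-1) ^+ b * z * kneading x z - 1 = (-1) ^+ b * (z * kneading x z) by ring.
have ss : (-1) ^+ b * (-1) ^+ b = 1 :> A by rewrite -expr2 sqrr_sign.
have -> : (-1) ^+ b * z ^+ size v * ((-1) ^+ b * (z * kneading x z)) = Z * kneading x z.
  by rewrite /Z exprS -[RHS]mul1r -[X in _ = X * _]ss; ring.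
by rewrite [Z ^+ j.+1]exprSr; ring.
Qed.

Section Approximation.
Variable R : realType.

(** The letter b makes the sign of the block b :: v positive, so its contribution
    repeats periodically. As j grows, the polynomial of x followed by j blocks
    converges, uniformly in x, to kneading v z / (1 - z ^ (size v).+1), whose zero
    z0 persists by the minimum modulus principle. *)
Lemma kneading_root_approx (v : word) (b : bool) (z0 : R[i]) (e : R) :
  (forall A : comNzRingType, word_sign A v = (-1) ^+ b) ->
  cmod z0 < 1 -> kneading v z0 = 0 -> 0 < e ->
  exists j, forall x, exists z, [/\ cmod (z - z0) < e, cmod z < 1 &
    kneading (x ++ flatten (nseq j (b :: v))) z = 0].
Proof.
move=> sv z01 qv0 e0.
have Q0 (u : word) : (kneading u 'X : {poly R[i]}) != 0.
  by rewrite -size_poly_eq0; case: (size_lead_kneading (R[i] : comNzRingType) u) => ->.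
have e'0 : 0 < Num.min e ((1 - cmod z0) / 2) by rewrite lt_min e0 /=; lra.
have [rho [mu [/andP[rho0 rhoe] mu0 mulow]]] := circle_lower_bound z0 (Q0 v) e'0.
have rho_e : rho <= e by rewrite (le_trans rhoe) // ge_min lexx.
have rho_z : rho <= (1 - cmod z0) / 2 by rewrite (le_trans rhoe) // ge_min lexx orbT.
pose r := cmod z0 + rho.
have r01 : 0 <= r < 1 by rewrite /r; apply/andP; split; have := cmod_ge0 z0; lra.
have /andP[r0 r1] := r01.
have K0 : 0 < (1 - r)^-1 by rewrite invr_gt0 subr_gt0.
set K := (1 - r)^-1 in K0.
pose del := mu / (mu + 6 * K).
have d0 : 0 < mu + 6 * K by lra.
have [j rj] : exists j, (r ^+ (size v).+1) ^+ j < del.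
  apply: expr_lt_eps; last by rewrite divr_gt0.
  by rewrite exprn_ge0 // exprn_ilt1.
exists j => x; set w := x ++ _.
set rj' := (_ ^+ j) in rj.
have rj0 : 0 <= rj' by rewrite !exprn_ge0.
have rjE : rj' * (mu + 6 * K) < mu by move: rj; rewrite /del ltr_pdivlMr.
have kw (z : R[i]) : kneading w z = kneading v z * (\sum_(i < j) (z ^+ (size v).+1) ^+ i)
    + (z ^+ (size v).+1) ^+ j * kneading x z by apply: kneading_repeat.
apply: contrapT => nex.
have nroot y : root (kneading w 'X) y -> rho <= cmod (y - z0).
  rewrite rootE horner_kneading leNgt => /eqP wy; apply/negP => yz.
  apply: nex; exists y; split => //; first lra.
  have := cmodD (y - z0) z0; rewrite subrK; lra.
pose mu' := mu * (1 - rj') / 2 - rj' * K.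
have mu'gt : 2 * (rj' * K) < mu' by rewrite /mu'; nra.
have mu'0 : 0 <= mu' by apply: le_trans (ltW mu'gt); rewrite !mulr_ge0 // ltW.
have /(_ _) := min_modulus rho0 mu'0 (Q0 w) nroot.
rewrite horner_kneading (kw z0) qv0 mul0r add0r cmodM !cmodX => h.
have {h} : mu' <= 2 * ((cmod z0 ^+ (size v).+1) ^+ j * cmod (kneading x z0)).
  apply: h => zeta z1; rewrite horner_kneading kw.
  set z := z0 + _.
  have zr : cmod z <= r.
    by rewrite (le_trans (cmodD _ _)) // cmodM cmod_real z1 mulr1 gtr0_norm.
  set Z := z ^+ (size v).+1.
  have Zj : cmod (Z ^+ j) <= rj'.
    by rewrite !cmodX /rj' !lerXn2r ?nnegrE ?exprn_ge0 ?cmod_ge0.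
  have Z1 : cmod Z <= 1 by rewrite cmodX exprn_ile1 ?cmod_ge0 //; lra.
  have Zsum : (1 - rj') / 2 <= cmod (\sum_(i < j) Z ^+ i).
    have := congr1 cmod (subrX1 Z j); rewrite cmodM => E.
    have h1 := cmodB_ge 1 (Z ^+ j); rewrite cmod1 -[cmod (1 - _)]cmodN opprB E in h1.
    have h2 := cmodD Z (-1); rewrite cmodN cmod1 in h2.
    have h3 := cmod_ge0 (\sum_(i < j) Z ^+ i).
    have h4 := cmod_ge0 (Z - 1).
    nra.
  have Hx : cmod (Z ^+ j * kneading x z) <= rj' * K.
    by rewrite cmodM ler_pM ?cmod_ge0 // cmod_kneading_le.
  have Hv : mu <= cmod (kneading v z) by have := mulow _ z1; rewrite horner_kneading.
  have := cmodB_ge (kneading v z * \sum_(i < j) Z ^+ i) (- (Z ^+ j * kneading x z)).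
  rewrite opprK cmodN [cmod (kneading v z * _)]cmodM => H3.
  have H : mu * ((1 - rj') / 2) <= cmod (kneading v z) * cmod (\sum_(i < j) Z ^+ i).
    have rj1 : rj' <= 1 by nra.
    by apply: ler_pM => //; lra.
  by rewrite /mu'; lra.
have h1 : (cmod z0 ^+ (size v).+1) ^+ j <= rj'.
  by rewrite !lerXn2r ?nnegrE ?exprn_ge0 ?cmod_ge0 // /r; lra.
have h2 : cmod (kneading x z0) <= K by apply: cmod_kneading_le => //; rewrite /r; lra.
move=> h4; have h3 : (cmod z0 ^+ (size v).+1) ^+ j * cmod (kneading x z0) <= rj' * K.
  by apply: ler_pM => //; rewrite ?exprn_ge0 ?cmod_ge0.
lra.
Qed.

(** * The unit circle is a limit of interior roots *)

(** The word is the golden mean polynomial 1 - g - g ^ 2 evaluated at g = z ^ M,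
    times the geometric sum 1 + ... + z ^ (M - 1). *)
Lemma kneading_golden (M : nat) (z : R[i]) : (0 < M)%N -> z != 1 ->
  1 - z ^+ M - z ^+ M * z ^+ M = 0 ->
  kneading (rcons (nseq (M + M).-1 false) true ++ nseq M.-1 false) z = 0.
Proof.
move=> M0 z1 g0.
have E k : (1 - z) * kneading (nseq k false) z = 1 - z ^+ k.+1.
  elim: k => [|k IH]; first by rewrite /kneading /= mulr1 expr1.
  rewrite -[X in nseq X]addn1 nseqD cats1 kneading_rcons expr0 mul1r.
  by rewrite mulrDr mulr1 mulrCA IH [in RHS]exprS; ring.
apply: (@mulfI _ (1 - z)); first by rewrite subr_eq0 eq_sym.
rewrite mulr0 kneading_cat word_sign_nseq0 size_nseq kneading_rcons expr1 mulrDr E.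
have -> : (1 - z) * (1 * z ^+ M.-1 * (1 + -1 * z * kneading (nseq (M + M).-1 false) z - 1))
  = - (z * z ^+ M.-1) * ((1 - z) * kneading (nseq (M + M).-1 false) z) by ring.
rewrite E -exprS !prednK ?addn_gt0 ?M0 // exprD.
set g := z ^+ M in g0 *.
have -> : 1 - g + - g * (1 - g * g) = (1 - g) * (1 - g - g * g) by ring.
by rewrite g0 mulr0.
Qed.

(** Of the two square roots, the one closer to 1 than to -1 satisfies
    |w' + 1| ^ 2 >= 1 + |w'| ^ 2 by the parallelogram law, and
    w - 1 = (w' - 1) (w' + 1): taking this root brings w closer to 1 by a definite
    factor. *)
Lemma sqrt_near1 (w : R[i]) (g : R) : 0 <= g -> g <= cmod w <= 1 ->
  exists w', w' ^+ 2 = w /\ cmod (w' - 1) ^+ 2 * (1 + g ^+ 2) <= cmod (w - 1) ^+ 2.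
Proof.
move=> g0 /andP[gw w1]; pose s := sqrtC w.
have para (x : R[i]) : cmod (x - 1) ^+ 2 + cmod (x + 1) ^+ 2 = 2 * (1 + cmod x ^+ 2).
  case: x => a b; rewrite /Normc.normc /= !sqr_sqrtr ?addr_ge0 ?sqr_ge0 //.
  by rewrite /= ?oppr0 ?addr0; ring.
have fac (x : R[i]) : x ^+ 2 = w -> cmod (w - 1) = cmod (x - 1) * cmod (x + 1).
  by move=> <-; rewrite -cmodM; congr cmod; ring.
have big (x : R[i]) : x ^+ 2 = w -> cmod (x - 1) <= cmod (x + 1) ->
    cmod (x - 1) ^+ 2 * (1 + g ^+ 2) <= cmod (w - 1) ^+ 2.
  move=> xw le1; rewrite (fac x xw) exprMn ler_wpM2l ?sqr_ge0 //.
  have x0 := cmod_ge0 x; have xx : cmod x ^+ 2 = cmod w by rewrite -cmodX xw.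
  have p := para x.
  have l2 : cmod (x - 1) ^+ 2 <= cmod (x + 1) ^+ 2 by rewrite lerXn2r ?nnegrE ?cmod_ge0.
  nra.
have s2 : s ^+ 2 = w by rewrite sqrtCK.
have [le1|/ltW le1] := leP (cmod (s - 1)) (cmod (s + 1)).
  by exists s; split=> //; exact: big.
exists (- s); rewrite sqrrN; split=> //; apply: big; first by rewrite sqrrN.
by rewrite -cmodN opprD !opprK -[leRHS]cmodN opprD opprK.
Qed.

Lemma root_near1 (k : nat) (w : R[i]) (g : R) : 0 <= g -> g <= cmod w <= 1 ->
  exists w', w' ^+ (2 ^ k) = w /\
             cmod (w' - 1) ^+ 2 * (1 + g ^+ 2) ^+ k <= cmod (w - 1) ^+ 2.
Proof.
move=> g0 gw; elim: k => [|k [w1 [E1 L1]]].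
  by exists w; rewrite expn0 expr1 expr0 mulr1.
have /andP[gw1 w11] : g <= cmod w1 <= 1.
  have := congr1 cmod E1; rewrite cmodX => E; move: gw; rewrite -E.
  have p0 : (0 < 2 ^ k)%N by rewrite expn_gt0.
  rewrite expr_le1 ?cmod_ge0 // => /andP[h1 h2]; rewrite h2 andbT.
  apply: le_trans h1 _; rewrite -(prednK p0) exprS ler_piMr ?cmod_ge0 //.
  by rewrite exprn_ile1 ?cmod_ge0.
have [w' [E' L']] := sqrt_near1 g0 (introT andP (conj gw1 w11)).
exists w'; split; first by rewrite expnS exprM E'.
apply: le_trans L1; rewrite [_ ^+ k.+1]exprS mulrA ler_wpM2r // exprn_ge0 //.
by have := sqr_ge0 g; lra.
Qed.

(** A point u of the circle is approximated by z = u w with w near 1 and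
    z ^ (2 ^ k) equal to the positive root g < 1 of 1 - g - g ^ 2. *)
Lemma circle_near_roots (u : R[i]) (e : R) : cmod u = 1 -> 0 < e ->
  exists z, [/\ cmod (z - u) < e, cmod z < 1 & exists v : word, kneading v z = 0].
Proof.
move=> u1 e0.
have [g g01 gE] : exists2 g : R, 0 < g < 1 & 1 - g - g * g = 0.
  have s0 : 0 <= Num.sqrt (5 : R) by rewrite sqrtr_ge0.
  have sE : Num.sqrt (5 : R) ^+ 2 = 5 by rewrite sqr_sqrtr //; lra.
  exists ((Num.sqrt 5 - 1) / 2); [apply/andP; split|]; nra.
have /andP[g0 g1] := g01.
have d0 : 0 < 1 + g ^+ 2 by nra.
have [k kE] : exists k, (1 + g ^+ 2)^-1 ^+ k < e ^+ 2 / 4.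
  apply: expr_lt_eps; last by rewrite divr_gt0 ?exprn_gt0.
  rewrite invr_ge0 (ltW d0) invf_lt1 //; nra.
have uk0 : u ^+ (2 ^ k) != 0 by rewrite -cmod_eq0 cmodX u1 expr1n oner_eq0.
have [|w [Ew Lw]] := @root_near1 k (g%:C / u ^+ (2 ^ k)) g (ltW g0).
  rewrite cmodM cmod_real Normc.normcV cmodX u1 expr1n invr1 mulr1 gtr0_norm //.
  by rewrite lexx ltW.
have zM : (u * w) ^+ (2 ^ k) = g%:C by rewrite exprMn Ew mulrCA divff // mulr1.
have p0 : (0 < 2 ^ k)%N by rewrite expn_gt0.
have z1 : cmod (u * w) < 1.
  have := congr1 cmod zM; rewrite cmodX cmod_real gtr0_norm // => h.
  by rewrite -(@expr_lt1 _ (2 ^ k)) ?cmod_ge0 // h.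
exists (u * w); split=> //.
  have -> : u * w - u = u * (w - 1) by ring.
  rewrite cmodM u1 mul1r.
  have c2 : cmod (g%:C / u ^+ (2 ^ k) - 1) <= 2.
    rewrite (le_trans (cmodD _ _)) // cmodN cmod1 cmodM cmod_real Normc.normcV.
    by rewrite cmodX u1 expr1n invr1 mulr1 gtr0_norm //; lra.
  have c3 : cmod (g%:C / u ^+ (2 ^ k) - 1) ^+ 2 <= 4.
    by have := cmod_ge0 (g%:C / u ^+ (2 ^ k) - 1); nra.
  have q0 : 0 < (1 + g ^+ 2) ^+ k by rewrite exprn_gt0.
  rewrite -(@ltr_pXn2r _ 2) ?nnegrE ?cmod_ge0 ?ltW //.
  move: kE; rewrite exprVn -[_ ^-1]div1r ltr_pdivrMr // => kE; nra.
exists (rcons (nseq (2 ^ k + 2 ^ k).-1 false) true ++ nseq (2 ^ k).-1 false).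
apply: kneading_golden => //.
  by apply: contraTneq z1 => ->; rewrite cmod1 ltxx.
by rewrite zM -[1]/(1%:C) -rmorphM -!rmorphB gE.
Qed.

End Approximation.

(** * Itineraries of a unimodal map and their number *)

Fixpoint all_words (n : nat) : seq word :=
  if n is m.+1 then map (cons false) (all_words m) ++ map (cons true) (all_words m)
  else [:: [::]].

Lemma mem_all_words n (w : word) : (w \in all_words n) = (size w == n).
Proof.
elim: n w => [|n IH] [|b w] //=.
  by rewrite mem_cat; apply/negbTE/norP; split; apply/mapP => -[].
have I : injective (cons b) by move=> u v [].
rewrite eqSS -IH mem_cat; case: b I => I; rewrite (mem_map I).
  by rewrite orb_idl // => /mapP [].
by rewrite orb_idr // => /mapP [].
Qed.

Lemma all_words_uniq n : uniq (all_words n).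
Proof.
elim: n => //= n IH; rewrite cat_uniq !map_inj_uniq ?IH //=; try by move=> u v [].
by rewrite andbT; apply/hasPn => w /mapP[u _ ->]; apply/mapP => -[].
Qed.

Section Itineraries.
Variables (R : realType) (c : R) (f : R -> R).

(** Putting c itself on the left is a convention; a single point changes the
    counts of itineraries by at most one. *)
Definition right_side (x : R) : bool := c < x.

Fixpoint itinerary (n : nat) (x : R) : word :=
  if n is m.+1 then right_side x :: itinerary m (f x) else [::].

Definition realized (n : nat) (A : set R) : seq word :=
  [seq w <- all_words n | `[< exists2 x, A x & itinerary n x = w >]].

Definition nwords (n : nat) (A : set R) : nat := size (realized n A).

Lemma size_itinerary n x : size (itinerary n x) = n.
Proof. by elim: n x => //= n IH x; rewrite IH. Qed.

Lemma itineraryD m k x :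
  itinerary (m + k) x = itinerary m x ++ itinerary k (iter m f x).
Proof. by elim: m x => //= m IH x; rewrite IH -iterSr. Qed.

Lemma mem_realized n A (w : word) :
  w \in realized n A <-> exists2 x, A x & itinerary n x = w.
Proof.
rewrite mem_filter mem_all_words; split=> [/andP[/asboolP //]|[x Ax <-]].
by rewrite size_itinerary eqxx andbT; apply/asboolP; exists x.
Qed.

Lemma realized_uniq n A : uniq (realized n A).
Proof. by rewrite filter_uniq ?all_words_uniq. Qed.

Lemma nwords_le n A B :
  (forall x, A x -> exists2 y, B y & itinerary n y = itinerary n x) ->
  (nwords n A <= nwords n B)%N.
Proof.
move=> AB; apply: uniq_leq_size (realized_uniq n A) _ => w /mem_realized[x /AB[y By yx] <-].
by apply/mem_realized; exists y.
Qed.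

Lemma nwords_subset n A B : A `<=` B -> (nwords n A <= nwords n B)%N.
Proof. by move=> AB; apply: nwords_le => x /AB; exists x. Qed.

Lemma nwords_gt0 n A x : A x -> (0 < nwords n A)%N.
Proof.
move=> Ax; rewrite -has_predT; apply/hasP; exists (itinerary n x) => //.
by apply/mem_realized; exists x.
Qed.

Lemma nwords_le1 n A :
  (forall x y, A x -> A y -> itinerary n x = itinerary n y) -> (nwords n A <= 1)%N.
Proof.
move=> h; have [[x Ax]|nA] := pselect (exists x, A x).
  apply: (@uniq_leq_size _ _ [:: itinerary n x]); first exact: realized_uniq.
  by move=> w /mem_realized[y Ay <-]; rewrite mem_seq1; apply/eqP/h.
apply: (@uniq_leq_size _ _ [:: [::]]); first exact: realized_uniq.
by move=> w /mem_realized[y Ay]; case: nA; exists y.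
Qed.

Lemma nwordsU n A B : (nwords n (A `|` B) <= nwords n A + nwords n B)%N.
Proof.
rewrite /nwords -size_cat; apply: uniq_leq_size; first exact: realized_uniq.
move=> w /mem_realized[x [Ax|Bx] xw]; rewrite mem_cat; apply/orP; [left|right];
  by apply/mem_realized; exists x.
Qed.

Lemma nwordsU_eq n A B (w0 : word) :
  (forall w, (exists2 x, A x & itinerary n x = w) /\
             (exists2 x, B x & itinerary n x = w) <-> w = w0) ->
  (nwords n (A `|` B) + 1 = nwords n A + nwords n B)%N.
Proof.
move=> AB; rewrite /nwords !size_filter -count_predUI; congr addn.
  apply: eq_count => w /=; apply/asboolP/orP.
    by move=> [x [Ax|Bx] xw]; [left|right]; apply/asboolP; exists x.
  by move=> [] /asboolP [x Ax xw]; exists x => //; [left|right].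
have w0n : size w0 = n.
  by have [_ /(_ erefl) [[x _ <-] _]] := AB w0; rewrite size_itinerary.
transitivity (count_mem w0 (all_words n)).
  by rewrite count_uniq_mem ?all_words_uniq // mem_all_words w0n eqxx.
apply: eq_count => w /=; apply/eqP/andP => [->|[/asboolP hA /asboolP hB]].
  by have [_ /(_ erefl) [hA hB]] := AB w0; split; apply/asboolP.
by apply/AB.
Qed.

Lemma nwords0 A x : A x -> nwords 0 A = 1%N.
Proof.
move=> Ax; apply/eqP; rewrite eqn_leq (nwords_gt0 _ Ax) andbT.
exact: nwords_le1.
Qed.

Lemma nwords_pow n A : (nwords n A <= 2 ^ n)%N.
Proof.
rewrite /nwords size_filter (leq_trans (count_size _ _)) //.
by elim: n => //= n IH; rewrite size_cat !size_map expnS mul2n -addnn leq_add.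
Qed.

Lemma nwords_side n A (s : bool) : (forall x, A x -> right_side x = s) ->
  nwords n.+1 A = nwords n (f @` A).
Proof.
move=> As; rewrite /nwords -(size_map (cons s) (realized n (f @` A))).
have I : injective (cons s) by move=> u v [].
apply: perm_size; apply: uniq_perm; rewrite ?map_inj_uniq ?realized_uniq //.
move=> w; apply/idP/mapP => [/mem_realized[x Ax <-]|[u /mem_realized[y [x Ax <-] <-] ->]].
  exists (itinerary n (f x)) => /=; last by rewrite As.
  by apply/mem_realized; exists (f x) => //; exists x.
by apply/mem_realized; exists x => //=; rewrite As.
Qed.

Lemma nwords_two_sides k A B :
  (forall x, A x -> right_side x = false) -> (forall x, B x -> right_side x = true) ->
  (nwords k (f @` A) + nwords k (f @` B) <= nwords k.+1 (A `|` B))%N.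
Proof.
move=> hA hB; rewrite -(nwords_side _ hA) -(nwords_side _ hB) /nwords -size_cat.
apply: uniq_leq_size; last first.
  move=> w; rewrite mem_cat => /orP[] /mem_realized[x xAB xw]; apply/mem_realized;
    exists x => //; [by left|by right].
rewrite cat_uniq !realized_uniq andbT /=; apply/hasPn => w /mem_realized[x xB <-].
apply/negP => /mem_realized[y yA] /= [] yx _.
by move: yx; rewrite hA // hB.
Qed.

Lemma nwordsD m k A :
  (nwords (m + k) A <= nwords m A * nwords k (iter m f @` A))%N.
Proof.
rewrite /nwords -(size_allpairs cat); apply: uniq_leq_size; first exact: realized_uniq.
move=> w /mem_realized[x Ax <-]; rewrite itineraryD.
apply: allpairs_f; apply/mem_realized; first by exists x.
by exists (iter m f x) => //; exists x.
Qed.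

Lemma nwords_time j k A : (j <= k)%N -> (nwords j A <= nwords k A)%N.
Proof.
move=> jk; rewrite /nwords -(size_map (take j) (realized k A)).
apply: uniq_leq_size; first exact: realized_uniq.
move=> w /mem_realized[x Ax <-]; apply/mapP; exists (itinerary k x).
  by apply/mem_realized; exists x.
by rewrite -(subnKC jk) itineraryD take_size_cat ?size_itinerary.
Qed.

Lemma nwords_cover (T : eqType) n (s : seq T) (B : T -> set R) A K :
  (forall x, A x -> exists2 t, t \in s & B t x) ->
  (forall t, t \in s -> (nwords n (B t) <= K)%N) ->
  (nwords n A <= size s * K)%N.
Proof.
elim: s A => [|t s IH] A AB BK.
  rewrite mul0n leqn0 size_eq0; apply/eqP; case E: (realized n A) => [//|w l].
  have : w \in realized n A by rewrite E mem_head.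
  by move=> /mem_realized[x /AB []].
pose A' := A `&` [set x | exists2 t, t \in s & B t x].
have -> : (size (t :: s) * K = K + size s * K)%N by [].
have : A `<=` B t `|` A'.
  move=> x Ax; have [u] := AB x Ax; rewrite in_cons => /predU1P[->|us] Bu; first by left.
  by right; split=> //; exists u.
move=> /(nwords_subset n) /leq_trans; apply; apply: leq_trans (nwordsU _ _ _) _.
apply: leq_add; first by rewrite BK ?mem_head.
by apply: IH => [x []//|u us]; rewrite BK // in_cons us orbT.
Qed.

End Itineraries.

Lemma finite_gap (R : realType) (K : seq R) :
  exists2 e : R, 0 < e & forall x y, x \in K -> y \in K -> x < y -> 2 * e < y - x.
Proof.
elim: K => [|x K [e e0 IH]]; first by exists 1.
have [d d0 Hd] : exists2 d : R, 0 < d & forall y, y \in K -> y != x -> 2 * d < `|y - x|.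
  elim: {IH} K => [|y K [d d0 IH]]; first by exists 1.
  have [->|yx] := eqVneq y x.
    by exists d => // z; rewrite in_cons => /predU1P[->|/IH //]; rewrite eqxx.
  have n0 : 0 < `|y - x| by rewrite normr_gt0 subr_eq0.
  exists (Num.min d (`|y - x| / 4)); first by rewrite lt_min d0 /=; lra.
  move=> z; rewrite in_cons => /predU1P[-> _|/IH h /h {}h].
    have : Num.min d (`|y - x| / 4) <= `|y - x| / 4 by rewrite ge_min lexx orbT.
    lra.
  by have : Num.min d (`|y - x| / 4) <= d by [rewrite ge_min lexx]; lra.
exists (Num.min e d); first by rewrite lt_min e0.
have me : Num.min e d <= e by rewrite ge_min lexx.
have md : Num.min e d <= d by rewrite ge_min lexx orbT.
move=> y z; rewrite !in_cons => /predU1P[->|yK] /predU1P[->|zK] yz; first lra.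
- have := Hd z zK; rewrite gt_eqF // => /(_ isT); rewrite gtr0_norm ?subr_gt0 //; lra.
- have := Hd y yK; rewrite lt_eqF // => /(_ isT); rewrite ltr0_norm ?subr_lt0 //; lra.
- have := IH y z yK zK yz; lra.
Qed.

Section UnimodalItineraries.
Variables (R : realType) (a b c : R) (f : R -> R).
Hypothesis f_stable : forall x, a <= x <= b -> a <= f x <= b.
Hypothesis f_incr : forall x y, a <= x -> x < y -> y <= c -> f x < f y.
Hypothesis f_decr : forall x y, c <= x -> x < y -> y <= b -> f y < f x.

Local Notation I := [set x | a <= x <= b].
Local Notation itin := (itinerary c f).
Local Notation nw := (nwords c f).

Lemma iter_stable n x : a <= x <= b -> a <= iter n f x <= b.
Proof. by move=> xI; elim: n => //= n /f_stable. Qed.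

Definition between (x y z : R) : bool := (x <= y <= z) || (z <= y <= x).

Lemma between_dist x y z : between x y z -> `|x - z| = `|x - y| + `|y - z|.
Proof.
case/orP => /andP[h1 h2].
  by rewrite !ler0_norm; lra.
by rewrite !ger0_norm; lra.
Qed.

Lemma between_image x y z : a <= x <= b -> a <= z <= b ->
  right_side c x = right_side c z -> between x y z ->
  right_side c y = right_side c x /\ between (f x) (f y) (f z).
Proof.
rewrite /right_side.
wlog xz : x z / x <= z => [hw xI zI xz bt|].
  have [le_xz|/ltW le_zx] := leP x z; first exact: hw.
  have bt' : between z y x by rewrite /between orbC.
  have [-> h] := hw z x le_zx zI xI (esym xz) bt'; split; first by rewrite xz.
  by rewrite /between orbC.
move=> /andP[ax xb] /andP[az zb] sxz bt.
have /andP[xy yz] : x <= y <= z by case/orP: bt => //; lra.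
have inc u v : a <= u -> u <= v -> v <= c -> f u <= f v.
  by move=> au; rewrite le_eqVlt => /orP[/eqP ->//|uv] vc; rewrite ltW // f_incr.
have dec u v : c <= u -> u <= v -> v <= b -> f v <= f u.
  by move=> cu; rewrite le_eqVlt => /orP[/eqP ->//|uv] vb; rewrite ltW // f_decr.
have [cx|xc] := ltP c x; rewrite /between.
  have cz : c < z by lra.
  split; first by apply/idP; lra.
  by apply/orP; right; rewrite !dec //; lra.
have zc : z <= c by rewrite leNgt -sxz -leNgt.
split; first by apply/negbTE; rewrite -leNgt; lra.
by apply/orP; left; rewrite !inc //; lra.
Qed.

(** Points with a common itinerary form a convex set on which every iterate up to
    time n is monotone. *)
Lemma itinerary_between n x y z : a <= x <= b -> a <= z <= b ->
  itin n x = itin n z -> between x y z ->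
  itin n y = itin n x /\
  forall k, (k <= n)%N -> between (iter k f x) (iter k f y) (iter k f z).
Proof.
elim: n x y z => [|n IH] x y z xI zI /=.
  by move=> _ bt; split=> // k; rewrite leqn0 => /eqP ->.
move=> [sxz ixz] bt; have [syx bt'] := between_image xI zI sxz bt.
have [iyx btn] := IH _ _ _ (f_stable xI) (f_stable zI) ixz bt'.
split; first by rewrite syx iyx.
by case=> // k ltk; rewrite !iterSr; apply: btn.
Qed.

(** ** Separated sets are not much larger than the number of itineraries *)

(** Each of the size l steps of the sorted list is longer than e at some time k,
    and at a fixed time the steps add up, by monotonicity. *)
Lemma sorted_separated_bound n e x (l : seq R) : 0 <= e ->
  (forall y, y \in x :: l -> a <= y <= b /\ itin n y = itin n x) ->
  path (fun y z => (y <= z) && `[< exists2 k, (k < n)%N &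
                                e < `|iter k f y - iter k f z| >]) x l ->
  e * (size l)%:R <= \sum_(k < n) `|iter k f x - iter k f (last x l)|.
Proof.
move=> e0; elim: l x => [|y l IH] x xl /=.
  by rewrite mulr0 sumr_ge0.
move=> /andP[/andP[xy /asboolP[k kn ek]] pl].
have tl z : z \in y :: l -> z \in [:: x, y & l] by move=> zl; rewrite in_cons zl orbT.
have yl : forall z, z \in y :: l -> a <= z <= b /\ itin n z = itin n y.
  move=> z zl; have [zI zx] := xl z (tl z zl); split=> //.
  by rewrite zx; have [_ ->] := xl y (tl y (mem_head _ _)).
have IHl := IH y yl pl.
have lastl : last y l \in y :: l by apply: mem_last.
have [lI lx] := xl _ (tl _ lastl).
have [xI _] := xl x (mem_head _ _).
have yz : y <= last y l.
  have : path <=%R y l by apply: sub_path pl => u v /andP[].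
  rewrite le_path_sortedE => /andP[/allP h _].
  by have := lastl; rewrite in_cons => /predU1P[->//|/h].
have bt : between x y (last y l) by rewrite /between xy yz.
have [_ btk] := itinerary_between xI lI (esym lx) bt.
have -> : \sum_(k < n) `|iter k f x - iter k f (last y l)| =
  \sum_(k < n) `|iter k f x - iter k f y| +
  \sum_(k < n) `|iter k f y - iter k f (last y l)|.
  by rewrite -big_split; apply: eq_bigr => i _; apply: between_dist; apply: btk; exact: ltnW.
rewrite -natr1 mulrDr mulr1 addrC lerD // (bigD1 (Ordinal kn)) //=.
by rewrite (le_trans (ltW ek)) // lerDl sumr_ge0.
Qed.

Lemma separated_class_bound n e (s : seq R) : 0 <= e -> a <= b ->
  nseparated `[a, b] f n e s ->
  (forall x y, x \in s -> y \in s -> itin n x = itin n y) ->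
  e * (size s)%:R <= e + n%:R * (b - a).
Proof.
move=> e0 ab [us sI sep] sitin; have ab0 : 0 <= b - a by rewrite subr_ge0.
have inI x : x \in s -> a <= x <= b by move=> /sI; rewrite /= in_itv.
rewrite -(size_sort <=%R s).
have : sorted <%R (sort <=%R s) by rewrite sort_lt_sorted.
have mems x : (x \in sort <=%R s) = (x \in s) by rewrite mem_sort.
case: (sort <=%R s) mems => [|x l] mems.
  by rewrite mulr0 addr_ge0 // mulr_ge0.
move=> /= pl; rewrite -natr1 mulrDr mulr1 addrC lerD2l.
have Hl : forall y, y \in x :: l -> a <= y <= b /\ itin n y = itin n x.
  by move=> y yl; split; [apply: inI|apply: sitin]; rewrite -mems // mem_head.
apply: le_trans (sorted_separated_bound e0 Hl _) _.
  apply: (@sub_in_path _ (mem s) <%R) pl; last by apply/allP => y; rewrite mems.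
  move=> y z ys zs ltyz; rewrite ltW //=; apply/asboolP.
  by apply: sep => //; rewrite lt_eqF.
rewrite -[n%:R](_ : \sum_(k < n) 1 = _); last by rewrite sumr_const card_ord.
rewrite mulr_suml; apply: ler_sum => k _; rewrite mul1r.
have xs : x \in s by rewrite -mems mem_head.
have ls : last x l \in s by rewrite -mems mem_last.
have /andP[h1 h2] := iter_stable k (inI _ xs).
have /andP[h3 h4] := iter_stable k (inI _ ls).
by rewrite ler_norml; apply/andP; split; lra.
Qed.

Lemma nseparated_sub n e (s s' : seq R) : subseq s' s ->
  nseparated `[a, b] f n e s -> nseparated `[a, b] f n e s'.
Proof.
move=> ss [us sI sep]; have mem := mem_subseq ss.
split; first exact: subseq_uniq us.
  by move=> x /mem /sI.
by move=> x y /mem xs /mem ys; apply: sep.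
Qed.

Lemma separated_bound n e (s : seq R) : 0 <= e -> a <= b ->
  nseparated `[a, b] f n e s ->
  e * (size s)%:R <= (nw n I)%:R * (e + n%:R * (b - a)).
Proof.
move=> e0 ab sep; have [us sI _] := sep.
have cover : (size s <= \sum_(w <- realized c f n I)
                size [seq x <- s | itin n x == w])%N.
  have sI' : {subset s <= I} by move=> x /sI; rewrite /= in_itv inE.
  elim: {us sep sI} s sI' => [|x s IH] xs //=.
  have : itin n x \in realized c f n I.
    by apply/mem_realized; exists x => //; have := xs x (mem_head _ _); rewrite inE.
  move=> xr; have := IH (fun y ys => xs y (mem_behead (s := x :: s) ys)) => {}IH.
  rewrite (big_rem _ xr) /= eqxx /= addSn ltnS (leq_trans IH) //.
  rewrite (big_rem _ xr) /= leq_add2l; apply: leq_sum => w _.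
  by case: ifP => // _; rewrite leqnSn.
have : e * (size s)%:R <= \sum_(w <- realized c f n I) (e + n%:R * (b - a)).
  apply: le_trans (_ : e * (\sum_(w <- realized c f n I)
                size [seq x <- s | itin n x == w])%N%:R <= _).
    by rewrite ler_wpM2l // ler_nat.
  rewrite natr_sum mulr_sumr; apply: ler_sum => w _.
  apply: separated_class_bound => //.
    by apply: nseparated_sub sep; exact: filter_subseq.
  by move=> x y; rewrite !mem_filter => /andP[/eqP -> _] /andP[/eqP -> _].
by rewrite big_const_seq count_predT iter_addr_0 => /le_trans; apply; rewrite [leRHS]mulr_natl.
Qed.

(** ** Blocks: a small ball meets at most three itineraries *)

Definition near_points (e t : R) : set R := [set x | a <= x <= b /\ `|x - t| <= e].

(** The cut points are the suprema of the itinerary classes: two points with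
    different itineraries have one of them in between. *)
Lemma small_ball_nwords m : exists2 e : R, 0 < e &
  forall t, (nw m (near_points e t) <= 3)%N.
Proof.
pose class (w : word) := [set x : R | a <= x <= b /\ itin m x = w].
pose K := [seq sup (class w) | w <- all_words m].
have cut x y : a <= x <= b -> a <= y <= b -> x < y -> itin m x != itin m y ->
    exists2 u, u \in K & x <= u <= y.
  move=> xI yI xy ixy; exists (sup (class (itin m x))).
    by apply: map_f; rewrite mem_all_words size_itinerary.
  have ub : ubound (class (itin m x)) y.
    move=> z [zI zx]; rewrite leNgt; apply/negP => yz.
    have bt : between x y z by rewrite /between (ltW xy) (ltW yz).
    by have [h _] := itinerary_between xI zI (esym zx) bt; rewrite h eqxx in ixy.
  apply/andP; split; last by apply: ge_sup => //; exists x.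
  by apply: ub_le_sup; [exists y|split].
have [e e0 gap] := finite_gap K.
exists e => // t.
have [[u uK /andP[ul ur]]|noK] := pselect (exists2 u, u \in K & t - e <= u <= t + e); last first.
  apply: (@leq_trans 1) => //; apply: nwords_le1.
  move=> x y; wlog xy : x y / x <= y.
    by move=> hw hx hy; have [h|/ltW h] := leP x y; [exact: hw|exact/esym/hw].
  move=> /= [xI]; rewrite ler_norml => /andP[x1 x2].
  move=> [yI]; rewrite ler_norml => /andP[y1 y2].
  move: xy; rewrite le_eqVlt => /orP[/eqP -> //|xy].
  apply/eqP; apply: contraT => /(cut _ _ xI yI xy) [u uK /andP[xu uy]].
  by case: noK; exists u => //; apply/andP; split; lra.
have only v : v \in K -> t - e <= v -> v <= t + e -> v = u.
  move=> vK v1 v2; have [uv|vu|//] := ltgtP u v.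
    by have := gap u v uK vK uv; lra.
  by have := gap v u vK uK vu; lra.
pose L := [set x | (a <= x <= b /\ `|x - t| <= e) /\ x < u].
pose G := [set x | (a <= x <= b /\ `|x - t| <= e) /\ u < x].
have sub : (near_points e t) `<=` (L `|` G) `|` [set u].
  by move=> x xP; have [h|h|h] := ltgtP x u; [left; left|left; right|right].
have one (B : set R) : (B = L \/ B = G) -> (nw m B <= 1)%N.
  move=> HB; apply: nwords_le1 => x y; wlog xy : x y / x <= y.
    by move=> hw hx hy; have [h|/ltW h] := leP x y; [exact: hw|exact/esym/hw].
  move=> Bx By; have [hx hy] : (a <= x <= b /\ `|x - t| <= e) /\ (a <= y <= b /\ `|y - t| <= e).
    by case: HB Bx By => -> [? _] [? _].
  case: hx => xI; rewrite ler_norml => /andP[x1 x2].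
  case: hy => yI; rewrite ler_norml => /andP[y1 y2].
  move: xy; rewrite le_eqVlt => /orP[/eqP -> //|xy].
  apply/eqP; apply: contraT => /(cut _ _ xI yI xy) [v vK /andP[xv vy]].
  have vu : v = u by apply: only => //; lra.
  by case: HB Bx By => -> [_ /= ux] [_ /= uy]; lra.
apply: leq_trans (nwords_subset _ _ _ sub) _.
apply: leq_trans (nwordsU _ _ _ _ _) _.
rewrite -[3%N]/(2 + 1)%N; apply: leq_add; last by apply: nwords_le1 => x y -> ->.
apply: leq_trans (nwordsU _ _ _ _ _) _.
by rewrite -[2%N]/(1 + 1)%N; apply: leq_add; apply: one; [left|right].
Qed.

(** The Bowen ball of t, cut to [a, b]. *)
Definition shadows (n : nat) (e : R) (t : R) : set R :=
  [set x | a <= x <= b /\ forall k, (k < n)%N -> `|iter k f x - iter k f t| <= e].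

(** Along an orbit followed for q blocks there are at most three choices per block. *)
Lemma shadows_nwords m e q t : (0 < m)%N ->
  (forall t, (nw m (near_points e t) <= 3)%N) ->
  (nw (q * m) (shadows (q * m) e t) <= 3 ^ q)%N.
Proof.
move=> m0 H; elim: q t => [|q IH] t.
  by rewrite mul0n expn0; apply: nwords_le1.
rewrite mulSn expnS; apply: leq_trans (nwordsD _ _ _ _ _) _.
apply: leq_mul.
  apply: leq_trans (H t); apply: nwords_subset => x [xI xt]; split=> //.
  by apply: (xt 0%N); rewrite addn_gt0 m0.
apply: leq_trans (IH (iter m f t)); apply: nwords_subset => _ [x [xI xt] <-].
split; first exact: iter_stable.
by move=> k kq; rewrite -!iterD addnC; apply: xt; rewrite ltn_add2l.
Qed.

(** A maximal separated subset of E shadows all of E. *)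
Lemma maximal_separated n e (E : seq R) : 0 <= e ->
  (forall x, x \in E -> a <= x <= b) ->
  exists s, nseparated `[a, b] f n e s /\
    forall x, x \in E -> exists2 t, t \in s & shadows n e t x.
Proof.
move=> e0; elim: E => [|x E IH] EI; first by exists [::].
have xI := EI x (mem_head _ _).
have [|s [[us sI ssep] sE]] := IH; first by move=> y yE; apply: EI; rewrite in_cons yE orbT.
have [[t ts tx]|nsh] := pselect (exists2 t, t \in s & shadows n e t x).
  exists s; split; first by [].
  by move=> y; rewrite in_cons => /predU1P[->|/sE //]; exists t.
have far y : y \in s -> exists2 k, (k < n)%N & e < `|iter k f x - iter k f y|.
  move=> ys; apply: contrapT => nk; apply: nsh; exists y => //; split=> // k kn.
  by rewrite leNgt; apply/negP => h; apply: nk; exists k.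
have xs : x \notin s.
  apply/negP => xs; have [k _] := far x xs; rewrite subrr normr0 => h; lra.
exists (x :: s); split.
  split; first by rewrite /= xs us.
    by move=> y; rewrite in_cons => /predU1P[->|/sI //]; rewrite /= in_itv.
  move=> y z; rewrite !in_cons => /predU1P[->|ys] /predU1P[->|zs]; rewrite ?eqxx //.
  - by move=> _; exact: far.
  - by move=> _; have [k kn h] := far y ys; exists k => //; rewrite distrC.
  - exact: ssep.
move=> y; rewrite in_cons => /predU1P[->|/sE [t ts ty]].
  by exists x; rewrite ?mem_head //; split=> // k _; rewrite subrr normr0.
by exists t; rewrite ?in_cons ?ts ?orbT.
Qed.

Lemma separated_lower m e q : (0 < m)%N -> 0 <= e ->
  (forall t, (nw m (near_points e t) <= 3)%N) ->
  exists2 s, nseparated `[a, b] f (q * m) e s & (nw (q * m) I <= size s * 3 ^ q)%N.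
Proof.
move=> m0 e0 H; set n := (q * m)%N.
have /choice[g gP] : forall w, exists x, w \in realized c f n I -> a <= x <= b /\ itin n x = w.
  move=> w; have [/mem_realized[x xI xw]|_] := boolP (w \in realized c f n I).
    by exists x.
  by exists a.
pose E := [seq g w | w <- realized c f n I].
have [|s [ssep sE]] := @maximal_separated n e E e0.
  by move=> _ /mapP[w /gP[h _] ->].
exists s => //.
apply: (@leq_trans (nw n [set x | x \in E])).
  apply: nwords_le => x xI.
  have xr : itin n x \in realized c f n I by apply/mem_realized; exists x.
  by exists (g (itin n x)); [exact: map_f|have [] := gP _ xr].
apply: (nwords_cover (B := shadows n e)); first exact: sE.
by move=> t _; exact: shadows_nwords.
Qed.

End UnimodalItineraries.

(** * Entropy as the growth rate of the number of itineraries *)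

Section LogarithmicGrowth.
Variable R : realType.
Implicit Types (u : nat -> \bar R) (l : R).

Local Notation rate u := (limn_esup (fun n => ((n%:R : R)^-1)%:E * lne (u n))%E).

Lemma lne_le_expR (x : \bar R) l : (0 <= x)%E ->
  (lne x <= l%:E)%E = (x <= (expR l)%:E)%E.
Proof.
move=> x0; rewrite -(lee_lne (x := x)) ?lne_EFin ?expR_gt0 ?expRK //.
  by rewrite in_itv /= x0 leey.
by rewrite in_itv /= lee_fin expR_ge0 leey.
Qed.

Lemma lne_ge_expR (x : \bar R) l : (0 <= x)%E ->
  (l%:E <= lne x)%E = ((expR l)%:E <= x)%E.
Proof.
move=> x0; rewrite -(lee_lne (y := x)) ?lne_EFin ?expR_gt0 ?expRK //.
  by rewrite in_itv /= lee_fin expR_ge0 leey.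
by rewrite in_itv /= x0 leey.
Qed.

Lemma log_rate_le u l : (forall n, (0 <= u n)%E) ->
  (forall d, 0 < d -> exists N, forall n, (N <= n)%N ->
     (u n <= (expR (n%:R * (l + d)))%:E)%E) ->
  (rate u <= l%:E)%E.
Proof.
move=> u0 H; apply/lee_addgt0Pr => d d0; have [N HN] := H d d0.
apply: le_trans (_ : ereal_sup [set ((n%:R : R)^-1)%:E * lne (u n)
   | n in [set n | (N.+1 <= n)%N]]%E <= _)%E.
  by apply: ereal_inf_lbound; exists [set n | (N.+1 <= n)%N] => //; exists N.+1.
apply: ge_ereal_sup => _ [n /= Nn <-].
have n0 : 0 < n%:R :> R by rewrite ltr0n (leq_trans _ Nn).
by rewrite lee_pdivrMl // -EFinD -EFinM lne_le_expR // HN // ltnW.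
Qed.

Lemma log_rate_ge u l : (forall n, (0 <= u n)%E) ->
  (forall N, exists n, [/\ (N <= n)%N, (0 < n)%N & ((expR (n%:R * l))%:E <= u n)%E]) ->
  (l%:E <= rate u)%E.
Proof.
move=> u0 H; apply: le_ereal_inf_tmp => _ [V [N _ NV] <-].
have [n [Nn n0 un]] := H N.
apply: le_trans (ereal_sup_ubound _); last by exists n => //; exact: NV.
by rewrite lee_pdivlMl ?ltr0n // -EFinM lne_ge_expR.
Qed.

End LogarithmicGrowth.

Section EntropyGrowth.
Variables (R : realType) (a b c : R) (f : R -> R).
Hypothesis ab : a <= b.
Hypothesis f_stable : forall x, a <= x <= b -> a <= f x <= b.
Hypothesis f_incr : forall x y, a <= x -> x < y -> y <= c -> f x < f y.
Hypothesis f_decr : forall x y, c <= x -> x < y -> y <= b -> f y < f x.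

Local Notation I := [set x | a <= x <= b].
Local Notation nw := (nwords c f).

Let sep_bound := separated_bound f_stable f_incr f_decr.

Lemma max_nseparated_ge0 n e : (0 <= max_nseparated `[a, b] f n e)%E.
Proof. by apply: ereal_sup_ubound; exists [::]. Qed.

(** Separated sets exceed the number of itineraries by a factor linear in n only. *)
Lemma entropy_le (C rho : R) : 0 < C -> 1 <= rho ->
  (forall n, (nw n I)%:R <= C * rho ^+ n) ->
  (topological_entropy `[a, b] f <= (ln rho)%:E)%E.
Proof.
move=> C0 rho1 H; apply: ge_ereal_sup => _ [e /= e0 <-].
have rho0 : 0 < rho by apply: lt_le_trans rho1.
apply: log_rate_le => [n|d d0]; first exact: max_nseparated_ge0.
have ab0 : 0 <= b - a by rewrite subr_ge0.
pose K := C * (e + (b - a)) / e.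
have K0 : 0 < K by rewrite divr_gt0 // mulr_gt0 //; lra.
have [N KN] : exists N : nat, 8 * K / d ^+ 2 < N%:R.
  by exists (Num.bound (8 * K / d ^+ 2)); rewrite archi_boundP // divr_ge0 ?sqr_ge0 //; lra.
exists N.+1 => n Nn; apply: ge_ereal_sup => _ [s sep <-]; rewrite lee_fin.
have n1 : 1 <= n%:R :> R by rewrite ler1n (leq_trans _ Nn).
have nN : N%:R <= n%:R :> R by rewrite ler_nat ltnW.
have p0 : 0 < rho ^+ n by rewrite exprn_gt0.
have B1 : (size s)%:R <= K * (1 + n%:R) * rho ^+ n.
  have h1 := sep_bound (ltW e0) ab sep; have h2 := H n.
  have h3 : e + n%:R * (b - a) <= (1 + n%:R) * (e + (b - a)) by nra.
  rewrite -(ler_pM2l e0) (le_trans h1) //.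
  have -> : e * (K * (1 + n%:R) * rho ^+ n) =
            C * rho ^+ n * ((1 + n%:R) * (e + (b - a))).
    by rewrite /K; field; rewrite gt_eqF.
  by apply: ler_pM => //; rewrite addr_ge0 ?mulr_ge0 // ltW.
apply: le_trans B1 _.
have -> : n%:R * (ln rho + d) = ln rho *+ n + d * n%:R by rewrite -mulr_natr; ring.
rewrite expRD -lnXn // lnK ?posrE // mulrC ler_wpM2l ?(ltW p0) //.
have -> : d * n%:R = d * n%:R / 2 + d * n%:R / 2 by field.
rewrite expRD -expr2.
(* expR (d n) is at least (d n / 2) ^ 2, which outgrows the linear factor. *)
have h := expR_ge1Dx (d * n%:R / 2).
have dn0 : 0 < d * n%:R by rewrite mulr_gt0 //; lra.
have : 8 * K <= d ^+ 2 * n%:R.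
  have : 8 * K < d ^+ 2 * N%:R by rewrite [ltRHS]mulrC -ltr_pdivrMr // exprn_gt0.
  have : d ^+ 2 * N%:R <= d ^+ 2 * n%:R by rewrite ler_wpM2l ?sqr_ge0.
  lra.
move=> hK; have : (d * n%:R / 2) ^+ 2 <= expR (d * n%:R / 2) ^+ 2.
  by rewrite lerXn2r ?nnegrE ?expR_ge0 //; lra.
apply: le_trans.
have : 8 * K * n%:R <= d ^+ 2 * n%:R * n%:R by rewrite ler_wpM2r //; lra.
have : K * 1 <= K * n%:R by rewrite ler_wpM2l // ltW.
have -> : (d * n%:R / 2) ^+ 2 = d ^+ 2 * n%:R * n%:R / 4 by field.
lra.
Qed.

(** Cutting time into blocks of length m costs a factor 3 per block, that is
    ln 3 / m in the growth rate. *)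
Lemma entropy_ge (s : R) (N0 : nat) : 0 < s ->
  (forall n, (N0 <= n)%N -> s ^+ n <= (nw n I)%:R) ->
  ((ln s)%:E <= topological_entropy `[a, b] f)%E.
Proof.
move=> s0 H; apply/lee_addgt0Pr => d d0.
have ln30 : 0 <= ln (3 : R) by rewrite ln_ge0 // ler1n.
have [m mE] : exists m : nat, ln 3 / d < m%:R.
  by exists (Num.bound (ln 3 / d : R)); rewrite archi_boundP // divr_ge0 // ltW.
have m0 : (0 < m)%N by rewrite -(ltr0n R) (le_lt_trans _ mE) // divr_ge0 // ltW.
have [e e0 small] := small_ball_nwords f_stable f_incr f_decr m.
apply: le_trans (_ : (ln s - d)%:E + d%:E <= _)%E; first by rewrite -EFinD subrK.
apply: leeD2r; apply: le_trans (ereal_sup_ubound _); last by exists e.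
apply: log_rate_ge => [n|N]; first exact: max_nseparated_ge0.
pose q := maxn N0.+1 N; exists (q * m)%N.
have qm : (q <= q * m)%N by rewrite leq_pmulr.
have q0 : (0 < q)%N by rewrite (leq_trans _ (leq_maxl _ _)).
split; [by rewrite (leq_trans (leq_maxr N0.+1 N)) | by rewrite muln_gt0 q0 |].
have [l lsep lnw] := separated_lower f_stable q m0 (ltW e0) small.
apply: le_trans (ereal_sup_ubound _); last by exists l; first exact: lsep.
rewrite lee_fin.
have h1 : s ^+ (q * m) <= (nw (q * m) I)%:R.
  by apply: H; rewrite (leq_trans _ qm) // (leq_trans _ (leq_maxl _ _)).
have h2 : (nw (q * m) I)%:R <= (size l)%:R * 3 ^+ q :> R by rewrite -natrX -natrM ler_nat.
have p3 : 0 < 3 ^+ q :> R by rewrite exprn_gt0.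
rewrite -(ler_pM2r p3) (le_trans _ (le_trans h1 h2)) //.
have -> : 3 ^+ q = expR (q%:R * ln 3) :> R by rewrite expRM_natl lnK ?posrE.
have -> : s ^+ (q * m) = expR (q%:R * m%:R * ln s) by rewrite -natrM expRM_natl lnK ?posrE.
rewrite -expRD ler_expR natrM.
move: mE; rewrite ltr_pdivrMr // => mE.
have qr0 : 0 < q%:R :> R by rewrite ltr0n.
have : ln 3 * q%:R <= m%:R * d * q%:R by rewrite ler_wpM2r // ltW.
lra.
Qed.

Lemma nwords_mul (n q r : nat) : (nw (q * n + r) I <= nw n I ^ q * 2 ^ r)%N.
Proof.
elim: q => [|q IH]; first by rewrite mul0n add0n expn0 mul1n nwords_pow.
rewrite mulSn -addnA expnS -mulnA; apply: leq_trans (nwordsD _ _ _ _ _) _.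
rewrite leq_mul2l; apply/orP; right; apply: leq_trans IH; apply: nwords_subset.
by move=> _ [x xI <-]; exact: iter_stable.
Qed.

(** The number of itineraries is submultiplicative, so its growth rate is also
    its infimum. *)
Lemma nwords_ge_entropy (h : R) n : topological_entropy `[a, b] f = h%:E ->
  expR h ^+ n <= (nw n I)%:R.
Proof.
move=> entE; rewrite leNgt; apply/negP => lt_n.
have nw1 k : 1 <= (nw k I)%:R :> R.
  by rewrite ler1n (@nwords_gt0 _ _ _ _ _ a) //= lexx.
case: n lt_n => [|n] lt_n; first by move: (nw1 0%N); rewrite expr0 in lt_n; lra.
pose rho := expR (ln (nw n.+1 I)%:R / n.+1%:R : R).
have n0 : 0 < n.+1%:R :> R by rewrite ltr0n.
have nwpos k : 0 < (nw k I)%:R :> R by have := nw1 k; lra.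
have rho1 : 1 <= rho.
  by rewrite -[leLHS]expR0 ler_expR divr_ge0 ?ln_ge0 ?nw1 // ltW.
have rhoE : rho ^+ n.+1 = (nw n.+1 I)%:R.
  by rewrite /rho -expRM_natl mulrC divfK ?gt_eqF // lnK ?posrE.
have : (topological_entropy `[a, b] f <= (ln rho)%:E)%E.
  apply: (@entropy_le (2 ^+ n.+1)) => // k.
  rewrite {1}(divn_eq k n.+1).
  apply: le_trans (_ : (nw n.+1 I ^ (k %/ n.+1) * 2 ^ (k %% n.+1))%N%:R <= _).
    by rewrite ler_nat nwords_mul.
  rewrite natrM !natrX mulrC -rhoE -exprM; apply: ler_pM; rewrite ?exprn_ge0 //.
  - by rewrite ltW // (lt_le_trans _ rho1).
  - by rewrite ler_eXn2l ?ltr1n // ltnW // ltn_mod.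
  - by rewrite ler_weXn2l // mulnC leq_divM.
rewrite entE lee_fin /rho expRK ler_pdivlMr // -ler_expR lnK ?posrE //.
by rewrite mulrC expRM_natl; lra.
Qed.

Lemma nwords_lt_entropy (h s : R) N0 : topological_entropy `[a, b] f = h%:E ->
  expR h < s -> exists2 N, (N0 <= N)%N & (nw N I)%:R < s ^+ N.
Proof.
move=> entE hs; apply: contrapT => no.
have s0 : 0 < s := lt_trans (expR_gt0 h) hs.
have : ((ln s)%:E <= topological_entropy `[a, b] f)%E.
  apply: (@entropy_ge s N0) => // n Nn; rewrite leNgt; apply/negP => lt_n.
  by apply: no; exists n.
by rewrite entE lee_fin -ler_expR lnK ?posrE // leNgt hs.
Qed.

(** The upper bound ln 2 comes from the two letters; the real value h is what the
    definition of the limit set of conjugates asks for. *)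
Lemma entropy_finite (s : R) (N0 : nat) : 1 < s ->
  (forall n, (N0 <= n)%N -> s ^+ n <= (nw n I)%:R) ->
  exists h, topological_entropy `[a, b] f = h%:E /\ 1 < expR h.
Proof.
move=> s1 H; have s0 : 0 < s by lra.
have low := entropy_ge s0 H.
have up : (topological_entropy `[a, b] f <= (ln 2)%:E)%E.
  apply: (@entropy_le 1) => // [|n]; first by rewrite ler1n.
  by rewrite mul1r -natrX ler_nat nwords_pow.
case E: (topological_entropy `[a, b] f) low up => [h| |] // low up.
exists h; split=> //; rewrite lee_fin in low; rewrite -[ltLHS]expR0 ltr_expR (lt_le_trans _ low) // ln_gt0 //.
Qed.

End EntropyGrowth.

(** * The entropy is a zero of the kneading polynomial *)

Lemma bernoulli (R : realType) (x : R) n : 0 <= x <= 1 -> 1 - n%:R * (1 - x) <= x ^+ n.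
Proof.
move=> /andP[x0 x1]; elim: n => [|n IH]; first by rewrite mul0r subr0 expr0.
have : x * (1 - n%:R * (1 - x)) <= x * x ^+ n by rewrite ler_wpM2l.
have : 0 <= n%:R * ((1 - x) * (1 - x)) by rewrite !mulr_ge0 // subr_ge0.
by rewrite -natr1 exprS; lra.
Qed.

Definition seg (R : realType) (u v : R) : set R := [set t | u <= t <= v].

Section KneadingEntropy.
Variables (R : realType) (a b c : R) (f : R -> R).
Hypothesis acb : a <= c <= b.
Hypothesis f_between : forall u v y, a <= u -> u <= v -> v <= b ->
  Num.min (f u) (f v) <= y <= Num.max (f u) (f v) -> exists2 x, seg u v x & f x = y.
Hypothesis f_stable : forall x, a <= x <= b -> a <= f x <= b.
Hypothesis f_incr : forall x y, a <= x -> x < y -> y <= c -> f x < f y.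
Hypothesis f_decr : forall x y, c <= x -> x < y -> y <= b -> f y < f x.

Local Notation nw := (nwords c f).

Lemma nwords_split n u v w : a <= u -> u <= v -> v <= w -> w <= b ->
  (nw n (seg u w) + 1 = nw n (seg u v) + nw n (seg v w))%N.
Proof.
move=> au uv vw wb.
have -> : seg u w = seg u v `|` seg v w.
  apply/seteqP; split=> [t /andP[ut tw]|t [/andP[h1 h2]|/andP[h1 h2]]].
  - by have [tv|/ltW vt] := leP t v; [left|right]; apply/andP.
  - by apply/andP; split; lra.
  - by apply/andP; split; lra.
apply: (nwordsU_eq (w0 := itinerary c f n v)) => s; split; last first.
  by move=> ->; split; exists v => //; apply/andP.
move=> [[x /andP[ux xv] <-] [y /andP[vy yw] yx]].
have xI : a <= x <= b by apply/andP; split; lra.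
have yI : a <= y <= b by apply/andP; split; lra.
have bt : between x v y by rewrite /between xv vy.
by have [-> _] := itinerary_between f_stable f_incr f_decr xI yI (esym yx) bt.
Qed.

Let f_incr_le x y : a <= x -> x <= y -> y <= c -> f x <= f y.
Proof. by move=> ax; rewrite le_eqVlt => /orP[/eqP ->//|xy yc]; rewrite ltW // f_incr. Qed.

Let f_decr_le x y : c <= x -> x <= y -> y <= b -> f y <= f x.
Proof. by move=> ax; rewrite le_eqVlt => /orP[/eqP ->//|xy yc]; rewrite ltW // f_decr. Qed.

Lemma nwords_left n u v : a <= u -> u <= v -> v <= c ->
  nw n.+1 (seg u v) = nw n (seg (f u) (f v)).
Proof.
move=> au uv vc; have /andP[ac cb] := acb.
rewrite (@nwords_side _ _ _ _ _ false); last first.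
  by move=> x /andP[_ xv]; apply/negbTE; rewrite -leNgt; lra.
congr (nwords _ _ _ _); apply/seteqP; split=> [_ [x /andP[ux xv] <-]|y /andP[h1 h2]].
  by apply/andP; split; apply: f_incr_le; lra.
have [||||x xuv fx] := @f_between u v y; try lra; last by exists x.
by rewrite ge_min h1 le_max h2 orbT.
Qed.

(** On the right of c the single point c is exceptional, as it carries the letter
    of the left side. *)
Lemma nwords_right n u v : c <= u -> u <= v -> v <= b ->
  (nw n.+1 (seg u v) <= nw n (seg (f v) (f u)) + 1)%N /\
  (nw n (seg (f v) (f u)) <= nw n.+1 (seg u v) + 1)%N.
Proof.
move=> cu uv vb; have /andP[ac cb] := acb.
pose A := seg u v `&` [set x | c < x].
have EA : nw n.+1 A = nw n (f @` A).
  by apply: (@nwords_side _ _ _ _ _ true) => x [].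
have one k x : (nw k [set x] <= 1)%N by apply: nwords_le1 => y z -> ->.
split.
  have sub : seg u v `<=` A `|` [set c].
    move=> x /[dup] xuv /andP[ux xv].
    by have [cx|cx|->] := ltgtP c x; [left|lra|right].
  apply: leq_trans (nwords_subset _ _ _ sub) _; apply: leq_trans (nwordsU _ _ _ _ _) _.
  apply: leq_add (one _ _); rewrite EA; apply: nwords_subset.
  by move=> _ [x [/andP[ux xv] _] <-]; apply/andP; split; apply: f_decr_le; lra.
have sub : seg (f v) (f u) `<=` f @` A `|` [set f c].
  move=> y /andP[h1 h2].
  have [||||x /[dup] xuv /andP[ux xv] fx] := @f_between u v y; try lra.
    by rewrite ge_min h1 le_max h2 orbT.
  have [cx|cx|cx] := ltgtP c x; [left|lra|right]; last by rewrite cx.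
  by exists x.
apply: leq_trans (nwords_subset _ _ _ sub) _; apply: leq_trans (nwordsU _ _ _ _ _) _.
apply: leq_add (one _ _); rewrite -EA; apply: nwords_subset; exact: subIsetl.
Qed.

Local Notation z n x := ((nw n (seg a x))%:R : R).

Let af x : a <= x <= b -> a <= f x.
Proof. by move=> /f_stable /andP[]. Qed.

Let fb x : a <= x <= b -> f x <= b.
Proof. by move=> /f_stable /andP[]. Qed.

Lemma count_left n x : a <= x <= c -> z n.+1 c - z n.+1 x = z n (f c) - z n (f x).
Proof.
move=> /andP[ax xc]; have /andP[ac cb] := acb.
have xI : a <= x <= b by apply/andP; split; lra.
have := nwords_split n.+1 (lexx a) ax xc cb.
have := nwords_split n (lexx a) (af xI) (f_incr_le ax xc (lexx c)) (fb acb).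
rewrite (nwords_left n ax xc (lexx c)) => /(congr1 (fun k => k%:R : R)) + /(congr1 (fun k => k%:R : R)).
by rewrite !natrD; lra.
Qed.

Lemma count_right n x : c <= x <= b ->
  `|z n (f x) - z n (f c) + (z n.+1 x - z n.+1 c)| <= 1.
Proof.
move=> /andP[cx xb]; have /andP[ac cb] := acb.
have xI : a <= x <= b by apply/andP; split; lra.
have := nwords_split n.+1 (lexx a) ac cx xb.
have := nwords_split n (lexx a) (af xI) (f_decr_le (lexx c) cx xb) (fb acb).
have [] := nwords_right n (lexx c) cx xb; rewrite -(ler_nat R) natrD => h1.
rewrite -(ler_nat R) natrD => h2.
move=> /(congr1 (fun k => k%:R : R)) + /(congr1 (fun k => k%:R : R)).
by rewrite !natrD => h3 h4; rewrite ler_norml; apply/andP; split; lra.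
Qed.

(** Signed number of itineraries of length n between c and the i-th point of its
    orbit. *)
Definition gap (n i : nat) : R := z n (iter i f c) - z n c.

(** A branch of f carries the itineraries of length n.+1 between c and a point to
    those of length n between their images, reversing the order on the right of c. *)
Lemma gap_recursion n i :
  `|gap n i.+1 - (gap n 1 + (-1) ^+ right_side c (iter i f c) * gap n.+1 i)| <= 1.
Proof.
have /andP[h1 h2] := iter_stable f_stable i acb.
rewrite /gap /right_side iterS /=; case: ltP => hc.
  have := count_right n (introT andP (conj (ltW hc) h2)).
  rewrite expr1 mulN1r.
  set A := z n (f (iter i f c)); set B := z n (f c); set C := z n.+1 (iter i f c).
  by rewrite (_ : A - B + (C - z n.+1 c) = A - z n c - (B - z n c + - (C - z n.+1 c))) //; ring.
have := count_left n (introT andP (conj h1 hc)).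
rewrite expr0 mul1r => E.
rewrite (_ : _ - _ = 0) ?normr0 ?ler01 //; lra.
Qed.

Lemma count_bound n x : a <= x <= b -> 1 <= z n x <= (nw n (seg a b))%:R.
Proof.
move=> /andP[ax xb]; rewrite ler1n (@nwords_gt0 _ _ _ _ _ a) /=; last first.
  by rewrite /seg /= lexx.
rewrite ler_nat; apply: nwords_subset => t /andP[h1 h2]; apply/andP; split; lra.
Qed.

Section Sums.
Variables (s : R) (N : nat).
Hypothesis s1 : 1 < s.
Hypothesis sN : (nw N (seg a b))%:R <= s ^+ N.

Let t := s^-1.
Let G := (1 - t)^-1.
Local Notation sum x := (\sum_(n < N) x n * t ^+ n).
Let S i := sum (fun n => gap n i).
Let A := sum (fun n => z n c).
Let D := G + s.

Let s_gt0 : 0 < s. Proof. exact: lt_trans ltr01 s1. Qed.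
Let t_gt0 : 0 < t. Proof. by rewrite invr_gt0. Qed.
Let t_lt1 : t < 1. Proof. by rewrite invf_lt1. Qed.
Let st : s * t = 1. Proof. by rewrite divff // gt_eqF. Qed.
Let G_gt0 : 0 < G. Proof. by rewrite invr_gt0 subr_gt0. Qed.

Lemma geometric_le : sum (fun=> 1) <= G.
Proof.
under eq_bigr do rewrite mul1r.
have := subrX1 t N; have := exprn_gt0 N t_gt0 => p E.
have d : 0 < 1 - t by rewrite subr_gt0.
have -> : \sum_(n < N) t ^+ n = (1 - t ^+ N) * G.
  by apply: (mulIf (lt0r_neq0 d)); rewrite -mulrA mulVf ?gt_eqF //; lra.
by rewrite ler_piMl ?ltW //; lra.
Qed.

Lemma sum_shift (x : nat -> R) :
  sum (fun n => x n.+1) = s * (sum x - x 0%N + x N * t ^+ N).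
Proof.
rewrite addrAC.
have -> : sum x + x N * t ^+ N = \sum_(n < N.+1) x n * t ^+ n by rewrite big_ord_recr.
rewrite big_ord_recl /= expr0 mulr1 addrC addKr mulr_sumr.
apply: eq_bigr => i _; rewrite /bump /= add1n exprS.
by rewrite [RHS]mulrCA [s * _]mulrA st mul1r.
Qed.

Lemma sum_recursion i :
  `|S i.+1 - (S 1 + (-1) ^+ right_side c (iter i f c) * s * S i)| <= D.
Proof.
pose sg := (-1) ^+ right_side c (iter i f c) : R.
pose er n := gap n i.+1 - (gap n 1 + sg * gap n.+1 i).
have yN : `|gap N i| * t ^+ N <= 1.
  have /andP[h1 h2] := count_bound N acb.
  have /andP[h3 h4] := count_bound N (iter_stable f_stable i acb).
  have : `|gap N i| <= s ^+ N.
    by apply: le_trans sN; rewrite /gap ler_norml; apply/andP; split; lra.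
  by move=> h; rewrite -(expr1n _ N) -st exprMn ler_wpM2r // exprn_ge0 // ltW.
have y0 : gap 0 i = 0.
  by rewrite /gap !(@nwords0 _ _ _ _ a) ?subrr // /seg /= lexx; [have /andP[] := acb
     | have /andP[] := iter_stable f_stable i acb].
have E : S i.+1 - (S 1 + sg * s * S i) = sum er + sg * (s * (gap N i * t ^+ N)).
  have -> : sum er = S i.+1 - (S 1 + sg * sum (fun n => gap n.+1 i)).
    rewrite mulr_sumr /S -big_split /= -sumrB; apply: eq_bigr => n _; rewrite /er; ring.
  by rewrite (sum_shift (fun n => gap n i)) y0 -/(S i); ring.
rewrite E (le_trans (ler_normD _ _)) // lerD //.
  apply: le_trans geometric_le; apply: le_trans (ler_norm_sum _ _ _) _.
  apply: ler_sum => n _; rewrite normrM [`|t ^+ n|]ger0_norm ?exprn_ge0 ?(ltW t_gt0) //.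
  by rewrite ler_wpM2r ?exprn_ge0 ?(ltW t_gt0) // gap_recursion.
rewrite !normrM normr_sign mul1r (gtr0_norm s_gt0).
by rewrite [`|t ^+ N|]ger0_norm ?exprn_ge0 ?(ltW t_gt0) // ler_piMr // ltW.
Qed.

Definition orbit_word (m : nat) : word :=
  [seq right_side c (iter i f c) | i <- iota 1 m].

(** Unrolling the recursion along the orbit of c reproduces the recursive definition
    of the kneading polynomial at s. *)
Lemma sum_kneading m :
  `|S m.+1 - kneading (orbit_word m) s * S 1| <= D * (m%:R * s ^+ m).
Proof.
have D0 : 0 < D by rewrite addr_gt0.
elim: m => [|m IH].
  by rewrite (_ : kneading _ _ = 1) // mul1r subrr normr0 mul0r mulr0.
have -> : orbit_word m.+1 = rcons (orbit_word m) (right_side c (iter m.+1 f c)).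
  by rewrite /orbit_word -[m.+1]addn1 iotaD map_cat cats1 add1n addn1.
rewrite kneading_rcons; set q := kneading _ _ in IH *.
have := sum_recursion m.+1; set sg := (-1) ^+ _ => h.
have -> : S m.+2 - (1 + sg * s * q) * S 1 =
   S m.+2 - (S 1 + sg * s * S m.+1) + sg * s * (S m.+1 - q * S 1) by ring.
rewrite (le_trans (ler_normD _ _)) //.
have h2 : `|sg * s * (S m.+1 - q * S 1)| <= s * (D * (m%:R * s ^+ m)).
  by rewrite !normrM normr_sign mul1r gtr0_norm // ler_wpM2l // ltW.
apply: le_trans (lerD h h2) _.
have p1 : 1 <= s ^+ m.+1 by rewrite exprn_ege1 // ltW.
have -> : s * (D * (m%:R * s ^+ m)) = D * (m%:R * s ^+ m.+1) by rewrite exprS; ring.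
by rewrite -natr1; nra.
Qed.

Lemma count_peak n : z n.+1 c <= z n (f c) + 1.
Proof.
have /andP[ac cb] := acb.
have := count_left n (introT andP (conj (lexx a) ac)).
have aI : a <= a <= b by apply/andP; split; lra.
have /andP[h1 _] := count_bound n (f_stable aI).
have h2 : z n.+1 a <= 1.
  rewrite lern1; apply: nwords_le1 => u v /andP[u1 u2] /andP[v1 v2].
  by congr itinerary; lra.
lra.
Qed.

Lemma nwords_le_peak n : (nw n.+1 (seg a b))%:R <= 2 * z n (f c) + 1.
Proof.
have /andP[ac cb] := acb.
have := nwords_split n.+1 (lexx a) ac cb (lexx b).
move=> /(congr1 (fun k => k%:R : R)); rewrite !natrD => E.
have [h1 _] := nwords_right n (lexx c) cb (lexx b).
rewrite -(ler_nat R) natrD in h1.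
have bI : a <= b <= b by apply/andP; split; lra.
have h2 : (nw n (seg (f b) (f c)) <= nw n (seg a (f c)))%N.
  apply: nwords_subset => x /andP[x1 x2]; apply/andP; split=> //.
  by have := af bI; lra.
rewrite -(ler_nat R) in h2.
have := count_peak n; lra.
Qed.

(** One more letter raises the number of itineraries on [a, c] by at most one more
    than the gap between c and f c, and [a, b] is covered by two preimages of
    [a, f c]: the generating function S 1 of that gap controls all itineraries,
    also those of points outside the convex hull of the orbit of c. *)
Lemma sum_nwords_le :
  sum (fun n => (nw n (seg a b))%:R) <= 1 + 2 * (G * (1 + `|S 1| + G)) + 2 * `|S 1| + G.
Proof.
have geo := geometric_le.
have step (x w : nat -> R) : (forall n, 0 <= x n) -> x 0%N = 1 ->
    (forall n, x n.+1 <= w n) -> sum x <= 1 + t * sum w.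
  move=> x0 x01 xw.
  have : sum x <= \sum_(n < N.+1) x n * t ^+ n.
    by rewrite big_ord_recr /= lerDl mulr_ge0 ?exprn_ge0 // ltW.
  move=> /le_trans; apply; rewrite big_ord_recl /= x01 expr0 mulr1 lerD2l mulr_sumr.
  apply: ler_sum => i _; rewrite /bump /= add1n exprS mulrCA ler_wpM2l ?(ltW t_gt0) //.
  by rewrite ler_wpM2r ?exprn_ge0 ?(ltW t_gt0).
have /andP[ac cb] := acb.
have S1A : S 1 + A = sum (fun n => z n (f c)).
  by rewrite -big_split; apply: eq_bigr => n _; rewrite /gap /= -mulrDl subrK.
have A0 : 0 <= A by apply: sumr_ge0 => n _; rewrite mulr_ge0 ?exprn_ge0 // ltW.
have hA : A <= 1 + t * (A + S 1 + sum (fun=> 1)).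
  have -> : A + S 1 + sum (fun=> 1) = sum (fun n => z n (f c) + 1).
    by rewrite [A + _]addrC S1A -big_split; apply: eq_bigr => n _ /=; ring.
  apply: (step (fun n => z n c) (fun n => z n (f c) + 1)) => // [|n]; last exact: count_peak.
  by rewrite (@nwords0 _ _ _ _ a) // /seg /= lexx.
have hL : sum (fun n => (nw n (seg a b))%:R) <= 1 + t * (2 * (S 1 + A) + sum (fun=> 1)).
  have -> : 2 * (S 1 + A) + sum (fun=> 1) = sum (fun n => 2 * z n (f c) + 1).
    by rewrite S1A mulr_sumr -big_split; apply: eq_bigr => n _ /=; ring.
  apply: (step (fun n => (nw n (seg a b))%:R) (fun n => 2 * z n (f c) + 1)) => // [|n];
    last exact: nwords_le_peak.
  by rewrite (@nwords0 _ _ _ _ a) // /seg /= lexx; lra.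
have geo0 : 0 <= sum (fun=> 1) by apply: sumr_ge0 => n _; rewrite mul1r exprn_ge0 // ltW.
have nS := ler_norm (S 1); have nS0 := normr_ge0 (S 1).
have GE : G * (1 - t) = 1 by rewrite mulVf // gt_eqF // subr_gt0.
have hA2 : A * (1 - t) <= 1 + `|S 1| + G.
  have : t * (S 1 + sum (fun=> 1)) <= `|S 1| + G.
    apply: le_trans (_ : t * (`|S 1| + G) <= _).
      by rewrite ler_wpM2l ?(ltW t_gt0) //; lra.
    by rewrite ler_piMl ?(ltW t_lt1) //; lra.
  lra.
have hA3 : A <= G * (1 + `|S 1| + G).
  have -> : A = G * (A * (1 - t)) by rewrite mulrCA GE mulr1.
  by rewrite ler_wpM2l // ltW.
have : t * (2 * (S 1 + A) + sum (fun=> 1)) <= 2 * `|S 1| + 2 * A + G.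
  apply: le_trans (_ : t * (2 * `|S 1| + 2 * A + G) <= _).
    by rewrite ler_wpM2l ?(ltW t_gt0) //; lra.
  by rewrite ler_piMl ?(ltW t_lt1) //; lra.
lra.
Qed.

End Sums.

(** As s decreases to expR h, the sum S 1 diverges with the generating function of
    the itineraries while its product with the kneading polynomial at s stays
    bounded. *)
Lemma kneading_entropy (p : nat) (h : R) : (0 < p)%N -> iter p f c = c ->
  topological_entropy `[a, b] f = h%:E -> 1 < expR h ->
  kneading (orbit_word p.-1) (expR h) = 0.
Proof.
move=> p0 pc entE; set lam := expR h => lam1.
have /andP[ac cb] := acb; have ab : a <= b by lra.
have lam0 : 0 < lam by exact: expR_gt0.
set m := p.-1; set v := orbit_word m.
apply/eqP; apply: contraT => q0.
pose del := `|kneading v lam| / 2.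
have del0 : 0 < del by rewrite divr_gt0 // normr_gt0.
have [eta eta0 etaP] := polyrcf.poly_cont lam (kneading v 'X) del0.
have qdel s : lam < s <= lam + eta / 2 -> del <= `|kneading v s|.
  move=> /andP[ls se]; have := etaP s; rewrite !horner_kneading gtr0_norm ?subr_gt0 //.
  move=> /(_ _) h1; have {h1} h1 : `|kneading v s - kneading v lam| < del by apply: h1; lra.
  have := ler_normB (kneading v s) (kneading v s - kneading v lam).
  by rewrite opprB addrCA subrr addr0; rewrite /del in h1 *; lra.
pose sm := lam + eta / 2.
have sm_gt : lam < sm by rewrite /sm; lra.
have sm0 : 0 < sm by lra.
pose G0 := (1 - lam^-1)^-1.
have il1 : lam^-1 < 1 by rewrite invf_lt1.
have G00 : 0 < G0 by rewrite invr_gt0 subr_gt0.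
pose X0 := (G0 + sm) * (m%:R * sm ^+ m) / del.
pose L0 := 1 + 2 * (G0 * (1 + X0 + G0)) + 2 * X0 + G0.
have X00 : 0 <= X0 by rewrite divr_ge0 ?(ltW del0) // !mulr_ge0 ?exprn_ge0 //; lra.
have L00 : 0 <= L0 by rewrite /L0; have : 0 <= G0 * (1 + X0 + G0); [rewrite mulr_ge0 //; lra | lra].
(* K exceeds twice the bound L0 on the generating function at s, whereas for s
   close to lam its first K terms are at least (lam / s) ^ n >= 1 / 2. *)
pose K := (Num.bound (2 * L0)).+1.
have KL : 2 * L0 < K%:R.
  by apply: lt_le_trans (_ : (Num.bound (2 * L0))%:R <= _); [rewrite archi_boundP //; lra|rewrite ler_nat].
have K0 : 0 < K%:R :> R by rewrite ltr0n.
pose x := Num.max (lam / sm) (1 - (2 * K%:R)^-1).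
have x1 : x < 1 by rewrite gt_max ltr_pdivrMr // mul1r sm_gt gtrBl invr_gt0 mulr_gt0.
have xl : lam / sm <= x by rewrite le_max lexx.
have xK : 1 - (2 * K%:R)^-1 <= x by rewrite le_max lexx orbT.
have x0 : 0 < x by apply: lt_le_trans xl; rewrite divr_gt0.
pose s := lam / x.
have ls : lam < s by rewrite /s ltr_pdivlMr // gtr_pMr.
have ssm : s <= sm by rewrite /s ler_pdivrMr // mulrC -ler_pdivrMr.
have s1 : 1 < s by lra.
have s0 : 0 < s by lra.
have [N KN sN] := nwords_lt_entropy f_stable f_incr f_decr K entE ls.
set X := `|\sum_(n < N) gap n 1 * s^-1 ^+ n|.
have Gs : (1 - s^-1)^-1 <= G0.
  rewrite lef_pV2 ?posrE ?subr_gt0 ?invf_lt1 //.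
  by rewrite lerD2l lerN2 lef_pV2 ?posrE // ltW.
have Gs0 : 0 < (1 - s^-1)^-1 by rewrite invr_gt0 subr_gt0 invf_lt1.
have XX : X <= X0.
  have := sum_kneading s1 (ltW sN) m; rewrite -/v /m prednK //.
  rewrite (_ : \sum_(n < N) gap n p * _ = 0); last first.
    by apply: big1 => n _; rewrite /gap pc subrr mul0r.
  rewrite sub0r normrN normrM -/X => hX.
  rewrite ler_pdivlMr // mulrC.
  have hq := qdel s (introT andP (conj ls ssm)).
  apply: le_trans (_ : `|kneading v s| * X <= _); first by rewrite ler_wpM2r ?normr_ge0.
  apply: le_trans hX _; apply: ler_pM; rewrite ?mulr_ge0 ?exprn_ge0 ?(ltW s0) //.
  - by rewrite addr_ge0 // ltW.
  - by rewrite lerD.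
  - by rewrite ler_wpM2l // lerXn2r ?nnegrE // ltW.
have := sum_nwords_le N s1; rewrite -/X => hL.
have {hL} hL : \sum_(n < N) (nw n (seg a b))%:R * s^-1 ^+ n <= L0.
  apply: le_trans hL _; rewrite /L0.
  have X_ge0 : 0 <= X by rewrite normr_ge0.
  have : (1 - s^-1)^-1 * (1 + X + (1 - s^-1)^-1) <= G0 * (1 + X0 + G0).
    by apply: ler_pM => //; lra.
  lra.
have hlow : K%:R / 2 <= \sum_(n < N) (nw n (seg a b))%:R * s^-1 ^+ n.
  apply: le_trans (_ : \sum_(n < K) x ^+ n <= _).
    rewrite -[K%:R / 2](_ : \sum_(n < K) 2^-1 = _); last first.
      by rewrite sumr_const card_ord mulr_natl.
    apply: ler_sum => n _; apply: le_trans (bernoulli n _); last by apply/andP; split; lra.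
    have nK : n%:R <= K%:R :> R by rewrite ler_nat ltnW.
    have : n%:R * (1 - x) <= K%:R * (2 * K%:R)^-1.
      by apply: ler_pM => //; lra.
    have -> : K%:R * (2 * K%:R)^-1 = 2^-1 :> R by field; rewrite gt_eqF.
    lra.
  apply: le_trans (_ : \sum_(n < N) x ^+ n <= _).
    rewrite -(subnKC KN) big_split_ord /= lerDl sumr_ge0 // => i _.
    by rewrite exprn_ge0 // ltW.
  apply: ler_sum => n _.
  have -> : x ^+ n = lam ^+ n * s^-1 ^+ n.
    by rewrite -exprMn /s invfM invrK mulrA divff ?mul1r // gt_eqF.
  rewrite ler_wpM2r ?exprn_ge0 ?invr_ge0 ?(ltW s0) //.
  exact: (nwords_ge_entropy ab f_stable f_incr f_decr n entE).
lra.
Qed.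

End KneadingEntropy.

(** * Critically periodic unimodal maps *)

Lemma near_both_sides (R : realType) (x d : R) (P : R -> Prop) : 0 < d ->
  (\forall t \near x, P t) -> exists e, [/\ 0 < e, e <= d, P (x - e) & P (x + e)].
Proof.
move=> d0 /nbhs_ballP [e /= e0 He]; exists (Num.min (e / 2) d).
have m0 : 0 < Num.min (e / 2) d by rewrite !lt_min d0 andbT; lra.
have me : Num.min (e / 2) d <= e / 2 by rewrite ge_min lexx.
have md : Num.min (e / 2) d <= d by rewrite ge_min lexx orbT.
split=> //; apply: He; rewrite /ball /=.
  by rewrite opprB addrCA subrr addr0 gtr0_norm //; lra.
by rewrite opprD addrA subrr add0r normrN gtr0_norm //; lra.
Qed.

Section UnimodalShape.
Variables (R : realType) (a b c : R) (f : R -> R).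
Hypothesis f_cont : {within `[a, b], continuous f}.
Hypothesis turning : forall x, interior_turning_point a b f x <-> x = c.

Let cont_sub u v : a <= u -> v <= b -> {within `[u, v], continuous f}.
Proof.
move=> au vb; apply: continuous_subspaceW f_cont => t /=; rewrite !in_itv /= => /andP[h1 h2].
by apply/andP; split; lra.
Qed.

Lemma intermediate_value u v y : a <= u -> u <= v -> v <= b ->
  Num.min (f u) (f v) <= y <= Num.max (f u) (f v) -> exists2 x, seg u v x & f x = y.
Proof.
move=> au uv vb h; have [x xuv fx] := IVT uv (cont_sub au vb) h.
by exists x => //; move: xuv; rewrite in_itv.
Qed.

(** Two points with the same image enclose a local extremum. *)
Lemma injective_off_turning u v : a <= u -> v <= b -> ~ (u < c < v) ->
  {in `[u, v] &, injective f}.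
Proof.
move=> au vb cuv.
have noext w x y : u <= x -> y <= v -> x < w < y ->
    (forall t, x <= t <= y -> f t <= f w) \/ (forall t, x <= t <= y -> f w <= f t) -> False.
  move=> ux yv /andP[xw wy] ext; apply: cuv.
  have nearI : \forall t \near w, x <= t <= y.
    have := @near_in_itvoo R x y w; rewrite in_itv /= xw wy => /(_ isT).
    by apply: filterS => t; rewrite in_itv /= => /andP[/ltW -> /ltW ->].
  have <- : w = c; last by apply/andP; split; lra.
  apply/turning; split; first by rewrite in_itv /=; apply/andP; split; lra.
  by case: ext => ext; [left|right]; apply: filterS nearI => t /ext.
suff H x y : u <= x -> y <= v -> x < y -> f x = f y -> False.
  move=> x y; rewrite !in_itv /= => /andP[ux xv] /andP[uy yv] fxy.
  have [xy|yx|//] := ltgtP x y; first by case: (H x y).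
  by case: (H y x).
move=> ux yv xy fxy.
have cxy : {within `[x, y], continuous f} by apply: cont_sub; lra.
have [M MI fM] := EVT_max (ltW xy) cxy.
have [m mI fm] := EVT_min (ltW xy) cxy.
have {}fM t : x <= t <= y -> f t <= f M by move=> tI; apply: fM; rewrite in_itv.
have {}fm t : x <= t <= y -> f m <= f t by move=> tI; apply: fm; rewrite in_itv.
move: MI mI; rewrite !in_itv /= => /andP[xM My] /andP[xm my].
have [hM|hM] := boolP (x < M < y); first by apply: (noext M x y) => //; left.
have [hm|hm] := boolP (x < m < y); first by apply: (noext m x y) => //; right.
have EM : f M = f x.
  move: hM; rewrite negb_and -!leNgt => /orP[h|h].
    by congr f; lra.
  by rewrite fxy; congr f; lra.
have Em : f m = f x.
  move: hm; rewrite negb_and -!leNgt => /orP[h|h].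
    by congr f; lra.
  by rewrite fxy; congr f; lra.
apply: (noext ((x + y) / 2) x y) => //; first by apply/andP; split; lra.
left => t tI; apply: le_trans (fM t tI) _; rewrite EM -Em; apply: fm.
by apply/andP; split; lra.
Qed.

(** On each side of c the map is strictly monotone; if it had the same direction on
    both sides, c would not be an extremum. *)
Lemma unimodal_shape : a < c < b ->
  ((forall x y, a <= x -> x < y -> y <= c -> f x < f y) /\
   (forall x y, c <= x -> x < y -> y <= b -> f y < f x)) \/
  ((forall x y, a <= x -> x < y -> y <= c -> f y < f x) /\
   (forall x y, c <= x -> x < y -> y <= b -> f x < f y)).
Proof.
move=> /andP[ac cb].
have mono u v : a <= u -> u <= v -> v <= b -> ~ (u < c < v) ->
    (forall x y, u <= x -> x < y -> y <= v -> f x < f y) \/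
    (forall x y, u <= x -> x < y -> y <= v -> f y < f x).
  move=> au uv vb cuv.
  have [H|H] := itv_continuous_inj_mono (cont_sub au vb) (injective_off_turning au vb cuv);
    [left|right] => x y ux xy yv; apply: H; rewrite ?in_itv //=; apply/andP; split; lra.
have pts (P : R -> Prop) : (\forall x \near c, P x) ->
    exists e, [/\ 0 < e, a <= c - e, c + e <= b, P (c - e) & P (c + e)].
  have d0 : 0 < Num.min (c - a) (b - c) by rewrite lt_min; apply/andP; split; lra.
  have d1 : Num.min (c - a) (b - c) <= c - a by rewrite ge_min lexx.
  have d2 : Num.min (c - a) (b - c) <= b - c by rewrite ge_min lexx orbT.
  by move=> /(near_both_sides d0) [e [e0 ed h1 h2]]; exists e; split=> //; lra.
have [iL|dL] := mono a c (lexx a) (ltW ac) (ltW cb) ltac:(rewrite ltxx andbF //);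
have [iR|dR] := mono c b (ltW ac) (ltW cb) (lexx b) ltac:(rewrite ltxx //);
  try by [left|right].
- have [_ /(_ erefl) [_ [] /pts [e [e0 ae eb h1 h2]]]] := turning c.
    by have := iR c (c + e) (lexx c); lra.
  by have := iL (c - e) c ae; lra.
- have [_ /(_ erefl) [_ [] /pts [e [e0 ae eb h1 h2]]]] := turning c.
    by have := dL (c - e) c ae; lra.
  by have := dR c (c + e) (lexx c); lra.
Qed.

End UnimodalShape.

(** ** Reflection exchanges maxima and minima *)

Definition reflect_map (R : realType) (f : R -> R) (x : R) : R := - f (- x).

Section Reflection.
Variable R : realType.
Implicit Types (f : R -> R) (a b : R).

Lemma reflect_mapK f : reflect_map (reflect_map f) = f.
Proof. by apply: funext => x; rewrite /reflect_map !opprK. Qed.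

Lemma iter_reflect f n x : iter n (reflect_map f) (- x) = - iter n f x.
Proof. by elim: n => //= n ->; rewrite /reflect_map opprK. Qed.

Lemma nseparated_reflect f a b n e (s : seq R) :
  nseparated `[a, b] f n e s ->
  nseparated `[- b, - a] (reflect_map f) n e [seq - x | x <- s].
Proof.
move=> [us sI sep]; split; first by rewrite map_inj_uniq //; exact: oppr_inj.
  move=> _ /mapP[x /sI + ->]; rewrite /= !in_itv /= => /andP[ax xb].
  by rewrite !lerN2 xb ax.
move=> _ _ /mapP[x xs ->] /mapP[y ys ->]; rewrite eqr_opp => xy.
have [k kn h] := sep x y xs ys xy; exists k => //.
by rewrite !iter_reflect -opprD normrN.
Qed.

Lemma entropy_reflect f a b :
  topological_entropy `[- b, - a] (reflect_map f) = topological_entropy `[a, b] f.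
Proof.
suff E n e : max_nseparated `[- b, - a] (reflect_map f) n e = max_nseparated `[a, b] f n e.
  rewrite /topological_entropy; congr (ereal_sup _); apply: eq_imagel => e _ /=.
  by congr (limn_esup _); apply: funext => n; rewrite E.
have le g u v : (max_nseparated `[u, v] g n e <=
    max_nseparated `[(- v)%R, (- u)%R] (reflect_map g) n e)%E.
  apply: ge_ereal_sup => _ [s sep <-]; apply: ereal_sup_ubound.
  by exists [seq - x | x <- s]; [exact: nseparated_reflect | rewrite size_map].
apply/eqP; rewrite eq_le le andbT.
by have := le (reflect_map f) (- b) (- a); rewrite reflect_mapK !opprK.
Qed.

End Reflection.

(** ** The entropy of a critically periodic unimodal map *)

Section CriticallyPeriodic.
Variable R : realType.

Lemma max_unimodal_entropy (a b c : R) f p h : a < c < b ->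
  (forall u v y, a <= u -> u <= v -> v <= b ->
    Num.min (f u) (f v) <= y <= Num.max (f u) (f v) -> exists2 x, seg u v x & f x = y) ->
  (forall x, a <= x <= b -> a <= f x <= b) ->
  (forall x y, a <= x -> x < y -> y <= c -> f x < f y) ->
  (forall x y, c <= x -> x < y -> y <= b -> f y < f x) ->
  (0 < p)%N -> iter p f c = c -> topological_entropy `[a, b] f = h%:E ->
  1 <= expR h /\ (1 < expR h -> exists v, kneading v (expR h) = 0).
Proof.
move=> /andP[ac cb] fbt fst finc fdec p0 pc entE.
have acb : a <= c <= b by apply/andP; split; lra.
have ab : a <= b by lra.
split.
  have : ((ln 1)%:E <= topological_entropy `[a, b] f)%E.
    apply: (entropy_ge (c := c) fst finc fdec (N0 := 0%N)) => // n _.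
    by rewrite expr1n ler1n (@nwords_gt0 _ _ _ _ _ a) //= lexx.
  by rewrite entE lee_fin ln1 -ler_expR expR0.
move=> h1; exists (orbit_word c f p.-1).
exact: (kneading_entropy acb fbt fst finc fdec p0 pc entE h1).
Qed.

Lemma critically_periodic_entropy (a b : R) f h :
  critically_periodic_unimodal a b f -> topological_entropy `[a, b] f = h%:E ->
  1 <= expR h /\ (1 < expR h -> exists v, kneading v (expR h) = 0).
Proof.
move=> [c [[[ab fc fst] turning] [p p0 pc]]] entE.
have acb : a < c < b by have [_ /(_ erefl) []] := turning c; rewrite in_itv.
have {}fst x : a <= x <= b -> a <= f x <= b by have := fst x; rewrite !in_itv.
have ivt := intermediate_value fc.
have [[finc fdec]|[fdec finc]] := unimodal_shape fc turning acb.
  exact: (max_unimodal_entropy acb ivt fst finc fdec p0 pc entE).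
rewrite -entropy_reflect in entE; have /andP[ac cb] := acb.
apply: (@max_unimodal_entropy (- b) (- a) (- c) (reflect_map f) p h) => //.
- by apply/andP; split; lra.
- move=> u v y bu uv va h1; have [||||x /andP[ux xv] fx] := ivt (- v) (- u) (- y); try lra.
    move: h1; rewrite /reflect_map -oppr_max -oppr_min => /andP[h1 h2].
    by rewrite minC maxC; apply/andP; split; lra.
  exists (- x); last by rewrite /reflect_map opprK fx opprK.
  by apply/andP; split; lra.
- move=> x /andP[bx xa]; rewrite /reflect_map.
  have /andP[h1 h2] : a <= f (- x) <= b by apply: fst; apply/andP; split; lra.
  by apply/andP; split; lra.
- by move=> x y bx xy yc; rewrite /reflect_map ltrN2; apply: finc; lra.
- by move=> x y cx xy ya; rewrite /reflect_map ltrN2; apply: fdec; lra.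
- by rewrite iter_reflect pc.
Qed.

Lemma galois_conjugate_kneading (v : word) (x : R) (z : R[i]) :
  kneading v x = 0 -> galois_conjugate z x%:C -> kneading v z = 0.
Proof.
move=> vx [p [p_irr px pz]].
pose q : {poly rat} := kneading v 'X.
have qE (t : R[i]) : (map_poly ratr q).[t] = kneading v t.
  by rewrite (map_poly_kneading (ratr : {rmorphism rat -> R[i]})) horner_kneading.
have qx : root (map_poly ratr q) x%:C.
  by rewrite rootE qE -(kneading_morph (real_complex R)) vx.
have : p %| q.
  have [s1|s1] := eqVneq (size (gcdp p q)) 1%N.
    have : coprimep (map_poly ratr p) (map_poly ratr q : {poly R[i]}).
      by rewrite coprimep_map coprimep_def s1.
    by move=> co; have := coprimep_root co px; rewrite (rootP qx) eqxx.
  have := p_irr.2 _ s1 (dvdp_gcdl _ _) => /eqp_dvdl <-; exact: dvdp_gcdr.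
move=> /dvdpP [r rE]; apply: (etrans (esym (qE z))).
by rewrite rE rmorphM hornerM (rootP pz) mulr0.
Qed.

Lemma galois_conjugate1 (z : R[i]) : galois_conjugate z 1 -> z = 1.
Proof.
move=> [p [p_irr p1 pz]].
have d : 'X - 1%:P %| p.
  rewrite dvdp_XsubCl; move: p1; rewrite -[X in root _ X](rmorph1 (ratr : {rmorphism rat -> R[i]})).
  by rewrite fmorph_root.
have : p %| 'X - 1%:P.
  by have := p_irr.2 _ _ d; rewrite size_XsubC => /(_ isT) /eqp_dvdl <-.
move=> /dvdpP [r rE].
have : (map_poly (ratr : {rmorphism rat -> R[i]}) ('X - 1%:P)).[z] = 0.
  by rewrite rE rmorphM hornerM (rootP pz) mulr0.
by rewrite rmorphB /= map_polyX map_polyC /= rmorph1 !hornerE => /subr0_eq.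
Qed.

End CriticallyPeriodic.

(** * A unimodal map for every word with a long initial run *)

Lemma unimodal_of_shape (R : realType) (a b c : R) f : a < c < b ->
  interval_self_map a b f ->
  (forall x y, a <= x -> x < y -> y <= c -> f x < f y) ->
  (forall x y, c <= x -> x < y -> y <= b -> f y < f x) ->
  unimodal a b f c.
Proof.
move=> /andP[ac cb] fI finc fdec; split=> // x; split=> [[]|->]; last first.
  split; first by rewrite in_itv /= ac.
  left; have := @near_in_itvoo R a b c; rewrite in_itv /= ac cb => /(_ isT).
  apply: filterS => t; rewrite in_itv /= => /andP[at_ tb].
  by have [tc|ct|->//] := ltgtP t c; apply: ltW; [apply: finc|apply: fdec]; lra.
rewrite in_itv /= => /andP[ax xb] ext; have [xc|cx|//] := ltgtP x c; exfalso.
  have d0 : 0 < Num.min (x - a) (c - x) by rewrite lt_min; apply/andP; split; lra.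
  have d1 : Num.min (x - a) (c - x) <= x - a by rewrite ge_min lexx.
  have d2 : Num.min (x - a) (c - x) <= c - x by rewrite ge_min lexx orbT.
  case: ext => /(near_both_sides d0) [e [e0 ed h1 h2]].
    by have := finc x (x + e); lra.
  by have := finc (x - e) x; lra.
have d0 : 0 < Num.min (x - c) (b - x) by rewrite lt_min; apply/andP; split; lra.
have d1 : Num.min (x - c) (b - x) <= x - c by rewrite ge_min lexx.
have d2 : Num.min (x - c) (b - x) <= b - x by rewrite ge_min lexx orbT.
case: ext => /(near_both_sides d0) [e [e0 ed h1 h2]].
  by have := fdec (x - e) x; lra.
by have := fdec x (x + e); lra.
Qed.

Section Coordinates.
Variable R : realType.

(** The inverse branches of the full tent map. *)
Definition tent_branch (b : bool) (y : R) : R := if b then 1 - y / 2 else y / 2.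

Definition coordinate (w : word) (y : R) : R := foldr tent_branch y w.

Lemma coordinate_affine w y :
  coordinate w y = coordinate w 0 + word_sign R w / 2 ^+ size w * y.
Proof.
elim: w => [|b w IH]; first by rewrite /word_sign big_nil expr0 divr1 mul1r add0r.
rewrite /= -/(coordinate w y) -/(coordinate w 0) IH word_sign_cons exprS.
have p0 : 2 ^+ size w != 0 :> R by rewrite expf_neq0 // pnatr_eq0.
by case: b; rewrite /tent_branch /= ?expr1 ?expr0; field.
Qed.

Lemma coordinate_bound w y : 0 <= y <= 1 -> 0 <= coordinate w y <= 1.
Proof.
move=> yI; elim: w => //= b w; rewrite -/(coordinate w y) => /andP[h1 h2].
by case: b; rewrite /tent_branch; apply/andP; split; lra.
Qed.

Lemma coordinate_nseq0 N w y : coordinate (nseq N false ++ w) y = coordinate w y / 2 ^+ N.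
Proof.
elim: N => [|N IH]; first by rewrite expr0 divr1.
by rewrite /= -/(coordinate _ y) IH /tent_branch exprS; field; rewrite expf_neq0 // pnatr_eq0.
Qed.

End Coordinates.

Section LongRunMap.
Variables (R : realType) (N : nat) (u : word).
Hypothesis u_sign : word_sign int u = 1.
Hypothesis u_short : ((size u).+3 <= N)%N.

Let W : word := rcons (long_run_word N u) false.
Let n := size W.

Let nE : n = (N + size u).+3.
Proof. by rewrite /n size_rcons size_long_run. Qed.

Let W_sign : word_sign R W = 1.
Proof.
have [b bE] := word_sign_letter u; have := u_sign; rewrite bE; case: b bE => // bE _.
by rewrite /W word_sign_rcons word_sign_long_run bE expr0 mulr1.
Qed.

(** The periodic point of the full tent map with itinerary W ^ oo. *)
Let xi : R := coordinate W (0 : R) / (1 - (2 ^+ n)^-1).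
Let X (i : nat) : R := coordinate (drop i W) xi.

Let n_gt0 : (0 < n)%N. Proof. by rewrite nE. Qed.

Let d_gt0 : 0 < 1 - (2 ^+ n)^-1 :> R.
Proof. by rewrite subr_gt0 invf_lt1 ?exprn_gt0 // exprn_egt1 ?ltr1n // -lt0n. Qed.

Let xiE : coordinate W xi = xi.
Proof.
have E : xi * (1 - (2 ^+ n)^-1) = coordinate W 0 by rewrite divfK // gt_eqF.
by rewrite coordinate_affine W_sign -E mul1r -/n; ring.
Qed.

Let xi01 : 0 <= xi <= 1.
Proof.
have /andP[h1 _] := @coordinate_bound R W 0 (introT andP (conj (lexx 0) ler01)).
have /andP[_ h2] := @coordinate_bound R W 1 (introT andP (conj ler01 (lexx 1))).
rewrite coordinate_affine W_sign mul1r mulr1 -/n in h2.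
apply/andP; split; first by rewrite divr_ge0 // ltW.
by rewrite ler_pdivrMr // mul1r; lra.
Qed.

Let X_bound i : 0 <= X i <= 1. Proof. exact: coordinate_bound. Qed.

Let X0 : X 0 = xi. Proof. by rewrite /X drop0 xiE. Qed.

Let Xn : X n = xi. Proof. by rewrite /X drop_size. Qed.

Let XS i : (i < n)%N -> X i = tent_branch (nth false W i) (X i.+1).
Proof. by move=> ltin; rewrite /X (drop_nth false ltin). Qed.

Let W0 i : (0 < i <= N)%N -> nth false W i = false.
Proof.
case: i => // i /= ltiN; rewrite /W -cats1 -catA nth_cat size_nseq ltiN.
by rewrite nth_nseq ltiN.
Qed.

Let xiN : xi = 1 - X N.+1 / 2 ^+ N.+1.
Proof.
rewrite -{1}xiE {1}/W /long_run_word rcons_cons /= -/(coordinate _ xi).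
rewrite rcons_cat coordinate_nseq0.
rewrite /X; have -> : drop N.+1 W = rcons (true :: u) false.
  by rewrite /W /long_run_word /= rcons_cat drop_size_cat // size_nseq.
by rewrite /tent_branch exprS; field; rewrite expf_neq0 // pnatr_eq0.
Qed.

Let X_half i : (i < n)%N -> X i.+1 / 2 <= X i.
Proof.
move=> /XS ->; have /andP[h1 h2] := X_bound i.+1.
by case: (nth _ _ _); rewrite /tent_branch; lra.
Qed.

Let pow_gt0 k : 0 < 2 ^+ k :> R. Proof. by rewrite exprn_gt0. Qed.

Let xi_half : 1 / 2 <= xi.
Proof.
have := XS n_gt0; rewrite X0 (_ : nth false W 0 = true) // /tent_branch.
have /andP[h1 h2] := X_bound 1; lra.
Qed.

Let X_low j : (j <= n)%N -> xi / 2 ^+ j <= X (n - j).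
Proof.
elim: j => [|j IH] ltjn; first by rewrite expr0 divr1 subn0 Xn.
have lt1 : (n - j.+1 < n)%N by rewrite ltn_subrL n_gt0.
have := X_half lt1; rewrite subnSK // => h; apply: le_trans h.
have := IH (ltnW ltjn); rewrite exprS invfM mulrCA; lra.
Qed.

Let X_gt0 i : (i <= n)%N -> 0 < X i.
Proof.
move=> lein; rewrite -(subKn lein); apply: lt_le_trans (X_low _); last exact: leq_subr.
by rewrite divr_gt0 //; have := xi_half; lra.
Qed.

Let kappa : R := (2 ^+ N.+1)^-1.

Let kappa_gt0 : 0 < kappa. Proof. by rewrite invr_gt0. Qed.

Let kappa_le : kappa <= 1 / 16.
Proof.
rewrite /kappa ler_pdivlMr // ler_pdivrMl //.
have -> : 16 = 2 ^+ 4 :> R by ring.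
by rewrite mulr1 ler_eXn2l ?ltr1n //; move: u_short; clear; lia.
Qed.

Let xi_ge : 1 - kappa <= xi.
Proof.
rewrite xiN lerD2l lerN2 /kappa ler_pdivrMr // mulVf ?gt_eqF //.
by have /andP[] := X_bound N.+1.
Qed.

Let xi_lt1 : xi < 1.
Proof.
rewrite xiN gtrBl divr_gt0 // X_gt0 // nE; lia.
Qed.

(** Only position 0 starts the longest run, so the other points of the orbit stay
    below the top one by a definite amount. *)
Let X_top i : (0 < i < n)%N -> X i <= xi - kappa.
Proof.
move=> /andP[i0 ltin].
suff : X i <= 1 - 2 * kappa by have := xi_ge; lra.
have /andP[h1 h2] := X_bound i.+1.
have := kappa_le; have := XS ltin; case E: (nth false W i); rewrite /tent_branch => XE kle; last lra.
have ltNi : (N < i)%N.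
  by rewrite ltnNge; apply/negP => leiN; rewrite W0 ?i0 // in E.
have := @X_low (n - i.+1) (leq_subr _ _); rewrite subKn // => low.
suff : 4 * kappa <= xi / 2 ^+ (n - i.+1) by lra.
apply: le_trans (_ : (1 / 2) / 2 ^+ (n - i.+1) <= _); last first.
  by rewrite ler_wpM2r // invr_ge0 ltW.
rewrite ler_pdivlMr // /kappa.
have : 2 ^+ (n - i.+1).+3 <= 2 ^+ N.+1 :> R.
  by rewrite ler_eXn2l ?ltr1n //; move: u_short ltin ltNi; rewrite nE; clear; lia.
move=> h; have k2 : (2 ^+ N.+1)^-1 * 2 ^+ N.+1 = 1 :> R by rewrite mulVf ?gt_eqF.
have := ler_wpM2l (ltW kappa_gt0) h; rewrite /kappa k2 !exprSr; lra.
Qed.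

Let p : R := xi / 2.

(** The tent map with its top cut along a slightly slanted line, so that the
    maximum xi is reached only at p. *)
Definition cut_tent (x : R) : R := Num.min (2 * x) (Num.min (2 - 2 * x) (xi - kappa * (x - p))).

Let cut_left x : x <= p -> cut_tent x = 2 * x.
Proof.
move=> xp; apply/min_idPl; rewrite le_min; move: xp; rewrite /p => xp.
have := kappa_gt0; have := xi_lt1 => h1 h2; apply/andP; split; first lra.
have : kappa * (x - xi / 2) <= 0 by rewrite mulr_ge0_le0 ?(ltW h2) //; lra.
lra.
Qed.

Let cut_right x : p <= x -> cut_tent x = Num.min (2 - 2 * x) (xi - kappa * (x - p)).
Proof.
move=> xp; apply/min_idPr; rewrite ge_min; apply/orP; right.
have : 0 <= kappa * (x - p) by rewrite mulr_ge0 ?(ltW kappa_gt0) //; lra.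
by move: xp; rewrite /p; lra.
Qed.

Let p01 : 0 < p < 1.
Proof. by rewrite /p; apply/andP; split; have := xi_half; have := xi_lt1; lra. Qed.

Let cut_incr x y : 0 <= x -> x < y -> y <= p -> cut_tent x < cut_tent y.
Proof. by move=> _ xy yp; rewrite !cut_left; lra. Qed.

Let cut_decr x y : p <= x -> x < y -> y <= 1 -> cut_tent y < cut_tent x.
Proof.
move=> px xy y1; rewrite !cut_right; try lra.
have h : kappa * (x - p) < kappa * (y - p) by rewrite ltr_pM2l //; lra.
by rewrite lt_min !gt_min; apply/andP; split; apply/orP; [left|right]; lra.
Qed.

Let cut_stable x : 0 <= x <= 1 -> 0 <= cut_tent x <= 1.
Proof.
move=> /andP[x0 x1]; have := kappa_le; have := kappa_gt0 => k0 k1.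
have /andP[p0 p1] := p01.
have : kappa * (x - p) <= kappa * 1 by rewrite ler_wpM2l ?(ltW k0) //; lra.
rewrite /cut_tent !le_min !ge_min => h; apply/andP; split.
  by apply/and3P; split; have := xi_half; lra.
by have [hx|hx] := leP x (1 / 2); apply/or3P; [apply: Or31|apply: Or32]; lra.
Qed.

Let cut_continuous : continuous cut_tent.
Proof.
move=> x; apply: (@continuous_min R R (fun x => 2 * x : R^o)
  (fun x => Num.min (2 - 2 * x) (xi - kappa * (x - p)) : R^o)).
  by apply: cvgM; [exact: cvg_cst|exact: cvg_id].
apply: (@continuous_min R R (fun x => 2 - 2 * x : R^o) (fun x => xi - kappa * (x - p) : R^o)).
  apply: cvgB; first exact: cvg_cst.
  by apply: cvgM; [exact: cvg_cst|exact: cvg_id].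
apply: cvgB; first exact: cvg_cst.
apply: cvgM; first exact: cvg_cst.
by apply: cvgB; [exact: cvg_id|exact: cvg_cst].
Qed.

Let X_le_xi i : (i <= n)%N -> X i <= xi.
Proof.
case: (posnP i) => [->|i0]; first by rewrite X0.
rewrite leq_eqVlt => /predU1P[->|lin]; first by rewrite Xn.
by apply: le_trans (X_top _) _; rewrite ?i0 // gerBl ltW // kappa_gt0.
Qed.

Let X_side i : (i < n)%N -> right_side p (X i) = nth false W i.
Proof.
move=> lin; rewrite XS // /right_side /p /tent_branch; have h := X_le_xi lin.
by case: (nth _ _ _); [apply/idP | apply/negbTE; rewrite -leNgt]; have := xi_lt1; lra.
Qed.

Let cut_p : cut_tent p = X 0.
Proof. by rewrite cut_left // X0 /p; field. Qed.

Let cut_X i : (i.+1 < n)%N -> cut_tent (X i) = X i.+1.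
Proof.
move=> lin; have lin' := ltnW lin; have := X_side lin'.
have h1 := @X_top i.+1 lin; have XE := XS lin'; rewrite /right_side.
case E: (nth false W i) XE; rewrite /tent_branch => XE side.
  rewrite cut_right ?(ltW side) //; apply/eqP; rewrite eq_le; apply/andP; split.
    by rewrite ge_min; apply/orP; left; lra.
  rewrite le_min; apply/andP; split; first lra.
  have /andP[_ x1] := X_bound i; have /andP[p0 _] := p01.
  have : kappa * (X i - p) <= kappa * 1 by rewrite ler_wpM2l ?(ltW kappa_gt0) //; lra.
  lra.
by rewrite cut_left; [lra | rewrite leNgt side].
Qed.

Let iter_cut i : (i < n)%N -> iter i.+1 cut_tent p = X i.
Proof.
elim: i => [|i IH] lin; first exact: cut_p.
by rewrite iterS IH ?cut_X // ltnW.
Qed.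

Let last_p : X n.-1 = p.
Proof.
have lt1 : (n.-1 < n)%N by rewrite prednK.
rewrite XS // prednK // Xn /p.
have -> : nth false W n.-1 = false.
  by rewrite /n /W size_rcons /= nth_rcons ltnn eqxx.
by [].
Qed.

Let cut_period : iter n cut_tent p = p.
Proof. by have := @iter_cut n.-1; rewrite prednK // => ->; rewrite ?last_p. Qed.

Let cut_orbit : orbit_word p cut_tent n.-1 = long_run_word N u.
Proof.
apply: (@eq_from_nth _ false).
  by rewrite size_map size_iota size_long_run nE.
move=> i; rewrite size_map size_iota => lin.
have lin' : (i < n)%N by rewrite (leq_trans lin) // leq_pred.
rewrite (nth_map 0%N) ?size_iota // nth_iota // add1n iter_cut // X_side //.
by rewrite nth_rcons size_long_run; move: lin; rewrite nE /= => ->.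
Qed.

Let cut_self_map : interval_self_map 0 1 cut_tent.
Proof.
split; [exact: ltr01 | exact: continuous_subspaceT | ].
by move=> x; rewrite !in_itv /=; exact: cut_stable.
Qed.

Let cut_ivt v w y : 0 <= v -> v <= w -> w <= 1 ->
  Num.min (cut_tent v) (cut_tent w) <= y <= Num.max (cut_tent v) (cut_tent w) ->
  exists2 x, seg v w x & cut_tent x = y.
Proof.
have [_ h _] := cut_self_map; move=> h1 h2 h3; exact: (intermediate_value h).
Qed.

(** Two branches suffice for exponential growth: B covers A and B, and A covers B.
    The intervals are chosen to fit below the cut, as xi >= 15 / 16 and
    kappa <= 1 / 16. *)
Let horseshoe_growth k :
  (2 ^ k <= nwords p cut_tent (k + k) (seg (9 / 16) (7 / 8) : set R))%N.
Proof.
set A : set R := seg (1 / 4) p; set B : set R := seg (9 / 16) (7 / 8).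
have k0 := kappa_gt0; have k1 := kappa_le; have x1 := xi_ge; have x2 := xi_lt1.
have pE : p = xi / 2 by [].
have c1 : cut_tent (1 / 4) = 1 / 2 by rewrite cut_left; lra.
have c2 : cut_tent p = xi by rewrite cut_p X0.
have c3 : 7 / 8 <= cut_tent (9 / 16).
  have : kappa * (9 / 16 - p) <= 1 / 16 * 1 by apply: ler_pM; lra.
  rewrite cut_right; last lra.
  by rewrite le_min => h; apply/andP; split; lra.
have c4 : cut_tent (7 / 8) <= 1 / 4.
  rewrite cut_right; last lra.
  by rewrite ge_min; apply/orP; left; lra.
have fA : B `<=` cut_tent @` A.
  move=> y /andP[y1 y2]; have [||||x xA <-] := @cut_ivt (1 / 4) p y; try lra; last by exists x.
  by rewrite c1 c2 ge_min le_max; apply/andP; split; apply/orP; [left|right]; lra.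
have fB : A `|` B `<=` cut_tent @` B.
  move=> y yAB; have /andP[y1 y2] : 1 / 4 <= y <= 7 / 8.
    by case: yAB => /andP[h1 h2]; apply/andP; split; lra.
  have [||||x xA <-] := @cut_ivt (9 / 16) (7 / 8) y; try lra; last by exists x.
  by rewrite ge_min le_max; apply/andP; split; apply/orP; [right|left]; lra.
have sA x : A x -> right_side p x = false by move=> /andP[_ h]; apply/negbTE; rewrite -leNgt.
have sB x : B x -> right_side p x = true by move=> /andP[h _]; apply/idP; rewrite /right_side; lra.
elim: k => [|k IH].
  by rewrite (@nwords_gt0 _ _ _ _ _ (9 / 16)) // /B /seg /=; apply/andP; split; lra.
rewrite addSn addnS expnS mul2n -addnn (nwords_side _ _ sB).
apply: leq_trans (nwords_subset _ _ _ fB).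
apply: leq_trans (nwords_two_sides _ _ sA sB).
apply: leq_add; apply: leq_trans IH (nwords_subset _ _ _ _) => //.
by move=> x xB; apply: fB; right.
Qed.

Let cut_growth k : (2 <= k)%N ->
  (6 / 5 : R) ^+ k <= (nwords p cut_tent k [set x : R | 0 <= x <= 1])%:R.
Proof.
move=> k2.
(* (6 / 5) ^ 2 < 2 leaves room for the factor lost when k is odd. *)
have e1 : (6 / 5 : R) ^+ k <= (6 / 5) * (36 / 25) ^+ k./2.
  have -> : 36 / 25 = (6 / 5) ^+ 2 :> R by field.
  rewrite -exprM -exprS ler_weXn2l //; first lra.
  by have := odd_double_half k; clear; lia.
have e2 : 6 / 5 * (36 / 25) ^+ k./2 <= 2 ^+ k./2 :> R.
  have : (0 < k./2)%N by rewrite half_gt0.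
  case: (k./2) => // j _; rewrite !exprS.
  have : (36 / 25 : R) ^+ j <= 2 ^+ j by rewrite lerXn2r ?nnegrE //; lra.
  have : 0 < 2 ^+ j :> R by []; lra.
apply: le_trans e1 (le_trans e2 _); rewrite -natrX ler_nat.
apply: leq_trans (horseshoe_growth _) _.
have sub : seg (9 / 16) (7 / 8) `<=` [set x : R | 0 <= x <= 1].
  by move=> x /andP[h1 h2]; apply/andP; split; lra.
apply: leq_trans (nwords_subset _ _ _ sub) _.
by apply: nwords_time; have := odd_double_half k; clear; lia.
Qed.

(** The critical orbit of the cut tent map has itinerary W, and its horseshoe makes
    the entropy positive. *)
Lemma long_run_entropy : exists (f : R -> R) (h : R),
  [/\ critically_periodic_unimodal 0 1 f, topological_entropy `[0, 1] f = h%:E &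
      kneading (long_run_word N u) (expR h) = 0].
Proof.
have /andP[p0 p1] := p01.
have s1 : 1 < 6 / 5 :> R by lra.
have [h [entE h1]] := entropy_finite ler01 cut_stable cut_incr cut_decr s1 cut_growth.
exists cut_tent, h; split=> //.
  exists p; split; first exact: unimodal_of_shape p01 cut_self_map cut_incr cut_decr.
  by exists n => //; exact: cut_period.
rewrite -cut_orbit; have pI : 0 <= p <= 1 by rewrite !ltW.
exact: (kneading_entropy pI cut_ivt cut_stable cut_incr cut_decr n_gt0 cut_period entE h1).
Qed.

End LongRunMap.

(** * The two closures *)

Section Closures.
Variable R : realType.
Implicit Types (z y : R[i]) (e : R).

Lemma closure_cmodP (A : set R[i]) z :
  closure A z <-> forall e, 0 < e -> exists2 y, A y & cmod (y - z) < e.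
Proof.
split=> [clA e e0|H B /nbhs_ballP[e /= e0 eB]].
  have [|y [Ay]] := clA (ball z e%:C).
    by apply/nbhs_ballP; exists e%:C => //=; rewrite ltcR.
  by rewrite -ball_normE /= normC_cmod ltcR -cmodN opprB; exists y.
have [|y Ay yz] := H (complex.Re e).
  by move: e0; rewrite ltcE => /andP[].
exists y; split=> //; apply: eB; rewrite -ball_normE /= normC_cmod -cmodN opprB.
have -> : e = (complex.Re e)%:C by rewrite RRe_real // realE ltW.
by rewrite ltcR.
Qed.

Lemma closed_unit_diskE z : closed_unit_disk z <-> cmod z <= 1.
Proof. by rewrite /closed_unit_disk /= normC_cmod -[1]/(1%:C) lecR. Qed.

Definition entropy_conjugate z : Prop := exists (a b : R) (f : R -> R) (h : R),
  [/\ critically_periodic_unimodal a b f, topological_entropy `[a, b] f = h%:E &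
      galois_conjugate z (expR h)%:C].

Definition parry_root z : Prop :=
  closed_unit_disk z /\ exists w : word, admissible_word w /\ parry w z = 0.

(** The approximating word ends with many copies of the given one and begins with a
    run of zeros that makes it admissible and realizable by a unimodal map, while
    its length and padding make the kneading polynomial irreducible. *)
Lemma kneading_root_near (v : word) z e : cmod z < 1 -> kneading v z = 0 -> 0 < e ->
  exists y, [/\ cmod (y - z) < e, entropy_conjugate y & parry_root y].
Proof.
move=> z1 vz e0; have [b vb] := word_sign_letter v.
have [j jP] := kneading_root_approx vb z1 vz e0.
set t := flatten (nseq j (b :: v)) in jP.
have t_sign : word_sign int t = 1.
  rewrite /t; elim: (j) => [|i IH]; first by rewrite /word_sign big_nil.
  by rewrite /= -cat_cons word_sign_cat IH word_sign_cons vb mulr1 -expr2 sqrr_sign.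
have [u0 [_ u_sign] irr] := padding_irreducible t_sign.
set u := u0 ++ t in u_sign irr.
(* The total length is a power of two at least twice as long as what follows the
   run. *)
pose k := (size u).+4.
have kS : (2 ^ k = 2 ^ (size u).+3 + 2 ^ (size u).+3)%N by rewrite /k [in LHS]expnS mul2n addnn.
have kL : ((size u).+3 < 2 ^ (size u).+3)%N by rewrite ltn_expl.
pose N := (2 ^ k - (size u).+3)%N.
have NL : ((size u).+3 <= N)%N by rewrite /N kS; lia.
have NE : (size (long_run_word N u)).+1 = (2 ^ k)%N by rewrite size_long_run /N kS; lia.
have [y [yz y1 yr]] := jP (true :: nseq N false ++ true :: u0).
have {}yr : kneading (long_run_word N u) y = 0.
  by rewrite -yr; congr kneading; rewrite /long_run_word /u /= -catA.
exists y; split=> //.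
  have [f [h [fP fE fr]]] := long_run_entropy R u_sign NL.
  exists 0, 1, f, h; split=> //; exists (kneading (long_run_word N u) 'X).
  split; first exact: (irr N k).
    rewrite rootE (map_poly_kneading (ratr : {rmorphism rat -> R[i]})) horner_kneading.
    by rewrite -(kneading_morph (real_complex R)) fr.
  by rewrite rootE (map_poly_kneading (ratr : {rmorphism rat -> R[i]})) horner_kneading yr.
split; first by apply/closed_unit_diskE; exact: ltW.
exists (rcons (long_run_word N u) false); split; first exact: long_run_admissible.
by rewrite parryE yr !mulr0.
Qed.

Lemma disk_root_near z e : cmod z <= 1 ->
  (cmod z < 1 -> exists v : word, kneading v z = 0) -> 0 < e ->
  exists y, [/\ cmod (y - z) < e, entropy_conjugate y & parry_root y].
Proof.
rewrite le_eqVlt => /orP[/eqP z1 _ e0|z1 /(_ z1) [v vz]]; last exact: kneading_root_near vz.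
have e2 : 0 < e / 2 by rewrite divr_gt0.
have [x [xz x1 [v vx]]] := circle_near_roots z1 e2.
have [y [yx yG yP]] := kneading_root_near x1 vx e2.
exists y; split=> //; have := cmodD (y - x) (x - z).
by rewrite addrA subrK; lra.
Qed.

Lemma entropy_conjugate_kneading z : entropy_conjugate z -> cmod z < 1 ->
  exists v : word, kneading v z = 0.
Proof.
move=> [a [b [f [h [fP fE zh]]]]] z1.
have [h1 hv] := critically_periodic_entropy fP fE.
move: h1; rewrite le_eqVlt => /orP[/eqP h1|/hv [v vh]].
  by move: z1; rewrite -h1 in zh; rewrite (galois_conjugate1 zh) cmod1 ltxx.
by exists v; exact: galois_conjugate_kneading vh zh.
Qed.

Lemma parry_root_kneading z : parry_root z -> cmod z < 1 ->
  exists v : word, kneading v z = 0.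
Proof.
move=> [_ [w [[w0 _ _]]]]; case/lastP: w w0 => // v b _ + z1.
rewrite parryE => /eqP; rewrite !mulf_eq0 signr_eq0 /= subr_eq0 => /orP[|/eqP vz].
  by move=> /eqP z_1; move: z1; rewrite z_1 cmod1 ltxx.
by exists v.
Qed.

End Closures.

Theorem corollary1p11 (R : realType) :
  @Omega2cp R `&` @closed_unit_disk R =
  closure [set z : R[i] | closed_unit_disk z /\
                          exists w : word, admissible_word w /\ parry w z = 0].
Proof.
apply/seteqP; split=> z.
  move=> [zO /closed_unit_diskE z1]; apply/closure_cmodP => e e0.
  have [/eqP zE|zN] := boolP (cmod z == 1).
    have [|y [yz _ yP]] := @disk_root_near R z e z1 _ e0; last by exists y.
    by rewrite zE ltxx.
  have zlt : cmod z < 1 by rewrite lt_neqAle zN.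
  have d0 : 0 < Num.min (e / 2) (1 - cmod z) by rewrite lt_min; apply/andP; split; lra.
  have de : Num.min (e / 2) (1 - cmod z) <= e / 2 by rewrite ge_min lexx.
  have dz : Num.min (e / 2) (1 - cmod z) <= 1 - cmod z by rewrite ge_min lexx orbT.
  have [x xG xz] := (closure_cmodP _ z).1 zO _ d0.
  have x1 : cmod x < 1 by have := cmodD (x - z) z; rewrite subrK; lra.
  have e2 : 0 < e / 2 by lra.
  have [y [yx _ yP]] := disk_root_near (ltW x1) (entropy_conjugate_kneading xG) e2.
  exists y => //; have := cmodD (y - x) (x - z); rewrite addrA subrK; lra.
move=> /closure_cmodP zP; split.
  apply/closure_cmodP => e e0; have e2 : 0 < e / 2 by lra.
  have [x xP xz] := zP _ e2; have /closed_unit_diskE x1 := xP.1.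
  have [y [yx yG _]] := disk_root_near x1 (parry_root_kneading xP) e2.
  exists y => //; have := cmodD (y - x) (x - z); rewrite addrA subrK; lra.
apply/closed_unit_diskE; rewrite leNgt; apply/negP => z1.
have [|x xP xz] := zP (cmod z - 1); first lra.
have /closed_unit_diskE x1 := xP.1.
by have := cmodB_ge z x; rewrite -[cmod (z - x)]cmodN opprB; lra.
Qed.
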